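(* Let $\pi:\mathrm{Conf}_n\mathcal{A}\to\mathrm{Conf}_nV$ be the map sending each flag to its first vector. There is a well-defined, surjective tropicalization of $\pi$, $$\pi^t:\mathrm{Conf}_n\mathcal{A}(\mathbb{Z}^t)\to\mathrm{Conf}_nV(\mathbb{Z}^t).$$ Moreover, suppose $y\in\mathrm{Conf}_nV(\mathcal{K}_{>0})$ satisfies $-\mathrm{val}(y)=y^t$, and suppose that under the map $\pi^t$ we have $\pi^t(x^t)=y^t$ for a point $x^t\in\mathrm{Conf}_n\mathcal{A}(\mathbb{Z}^t)$. Then there exists $x\in\mathrm{Conf}_n\mathcal{A}(\mathcal{K}_{>0})$ such that $\pi(x)=y$.
   Context: **Positive varieties and tropical points.** A positive variety $Y$ is a variety with a collection of birational coordinate systems (positive charts) whose transition functions are subtraction-free rational functions. A positive rational function is one that is subtraction-free in the coordinates of some (equivalently, every) positive chart. For a semifield $S$, $Y(S)$ is the set of assignments of values in $S$ to the coordinates of a positive chart, different charts being identified through the transition functions. $\mathbb{Z}^t$ is $\mathbb{Z}$ with multiplication, division, addition replaced by addition, subtraction, maximum; $\mathcal{K}_{>0}$ is the semifield of formal Laurent series in $t$ over $\mathbb{R}$ with positive leading coefficient. Positive rational functions $f$ have tropicalizations $f^t$. The map $-\mathrm{val}:Y(\mathcal{K}_{>0})\to Y(\mathbb{Z}^t)$ sends a point $z$ to the point $z^t$ with $f^t(z^t)=-\mathrm{val}\,f(z)$ for every positive rational function $f$. The tropicalization of a map $\pi:Y_1\to Y_2$ pulling back positive rational functions to positive rational functions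 is the map $\pi^t$ with $g^t(\pi^t(x^t))=(\pi^*g)^t(x^t)$ for all positive rational $g$ on $Y_2$. **Spaces.** $k\ge2$, $n\ge\max(k,3)$, $V=\mathbb{C}^k$, $G=SL_k$, $U\subset G$ maximal unipotent, $\mathcal{A}=G/U$. A point of $\mathcal{A}$ (principal flag) is an ordered basis $(v_1,\dots,v_k)$ with $v_1\wedge\dots\wedge v_k$ the standard volume form, up to having the same $v_1\wedge\dots\wedge v_i$ for all $i$. $\mathrm{Conf}_n\mathcal{A}=G\backslash\mathcal{A}^n$, $\mathrm{Conf}_nV=G\backslash V^n$ (identified with the affine cone over $\mathrm{Gr}(k,n)$). Positive charts are the clusters of the standard cluster structures (Fock–Goncharov for $\mathrm{Conf}_n\mathcal{A}$, Scott for $\mathrm{Conf}_nV$). One chart of $\mathrm{Conf}_nV$ consists of the Plücker coordinates $P_J=\det(v_{j_1},\dots,v_{j_k})$, $J=\{1,\dots,a\}\cup\{i,\dots,i+b-1\}$ with $a+b=k$, $a,b\ge0$, $i>a$. For every triangulation of the convex $n$-gon with vertices $1,\dots,n$, the functions $\det(v_{p1},\dots,v_{pi_1},v_{q1},\dots,v_{qi_2},v_{r1},\dots,v_{ri_3})$, for $p<q<r$ the vertices of a triangle, $i_1+i_2+i_3=k$, $0\le i_j<k$, and $F_p=(v_{p1},\dots,v_{pk})$ the $p$-th flag, form a chart of $\mathrm{Conf}_n\mathcal{A}$; all cluster charts are related by subtraction-free transition functions. *)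

(* Defs.v *)
From HB Require Import structures.
From mathcomp Require Import all_boot all_order all_algebra.
From mathcomp Require Import boolp reals complex.

Set Implicit Arguments.
Unset Strict Implicit.
Unset Printing Implicit Defensive.

Import Order.TTheory GRing.Theory Num.Theory.
Local Open Scope ring_scope.

Record semifield := Semifield {
  sf_sort :> Type;
  sf_add : sf_sort -> sf_sort -> sf_sort;
  sf_mul : sf_sort -> sf_sort -> sf_sort;
  sf_one : sf_sort;
  sf_inv : sf_sort -> sf_sort;
  sf_addA : associative sf_add;
  sf_addC : commutative sf_add;
  sf_mulA : associative sf_mul;
  sf_mulC : commutative sf_mul;
  sf_mul1 : left_id sf_one sf_mul;
  sf_mulV : left_inverse sf_one sf_inv sf_mul;
  sf_mulDr : right_distributive sf_mul sf_add
}.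

Definition Zt : semifield :=
  @Semifield int Num.max +%R 0 -%R (@maxA _ int) (@maxC _ int)
    (@addrA int) (@addrC int) (@add0r int) (@addNr int) (@addr_maxr int).

(* A Laurent series with positive leading coefficient is written uniquely as
   t^v * sum_i p_i t^i with v an integer and 0 < p_0. *)
Section LaurentPositive.
Variable R : realType.
Implicit Types (p q r : nat -> R) (d n : nat).

Definition conv p q n : R := \sum_(i < n.+1) p i * q (n - i)%N.
Definition shift d p n : R := if (n < d)%N then 0 else p (n - d)%N.
Definition inv_coefs p : nat -> seq R :=
  fix loop n := if n is n'.+1 then
    let s := loop n' in
    rcons s ((p 0)^-1 * ((n' == 0)%:R - \sum_(i < n') p (n' - i)%N * s`_i))
  else [::].
Definition conv_inv p n : R := (inv_coefs p n.+1)`_n.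

Record Kpos_type := KPos {
  kval : int;
  kcoef : nat -> R;
  kcoef_gt0 : 0 < kcoef 0
}.

Lemma Kpos_eq x y : kval x = kval y -> kcoef x =1 kcoef y -> x = y.
Proof.
case: x y => [v p p0] [w q q0] /= evw /funext epq.
by subst w q; congr KPos; exact: eq_irrelevance.
Qed.

Definition kdelta (x y : Kpos_type) : nat :=
  `|kval x - Num.min (kval x) (kval y)|%N.

Definition kadd_coef x y n : R :=
  shift (kdelta x y) (kcoef x) n + shift (kdelta y x) (kcoef y) n.

Lemma kadd_gt0 x y : 0 < kadd_coef x y 0.
Proof.
have sh0 d p : 0 < p 0%N -> 0 <= shift d p 0 by case: d => [|d] // /ltW.
have sh d p : d = 0%N -> shift d p 0 = p 0%N by move->.
rewrite /kadd_coef; have [le|lt] := leP (kval x) (kval y).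
  rewrite ltr_pwDl ?sh0 ?kcoef_gt0// sh ?kcoef_gt0//.
  by rewrite /kdelta min_l// subrr.
rewrite ltr_pwDr ?sh0 ?kcoef_gt0// sh ?kcoef_gt0//.
by rewrite /kdelta min_l ?subrr// ltW.
Qed.

Definition kadd x y :=
  @KPos (Num.min (kval x) (kval y)) (kadd_coef x y) (kadd_gt0 x y).

Lemma kmul_gt0 x y : 0 < conv (kcoef x) (kcoef y) 0.
Proof. by rewrite /conv big_ord_recl big_ord0 addr0 mulr_gt0 ?kcoef_gt0. Qed.

Definition kmul x y :=
  @KPos (kval x + kval y) (conv (kcoef x) (kcoef y)) (kmul_gt0 x y).

Lemma kone_gt0 : 0 < (0%N == 0%N)%:R :> R.
Proof. exact: ltr01. Qed.

Definition kone := @KPos 0 (fun n => (n == 0%N)%:R) kone_gt0.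

Lemma size_inv_coefs p n : size (inv_coefs p n) = n.
Proof. by elim: n => //= n IH; rewrite size_rcons IH. Qed.

Lemma nth_inv_coefs p n i : (i < n)%N -> (inv_coefs p n)`_i = conv_inv p i.
Proof.
elim: n => // n IH; rewrite ltnS leq_eqVlt => /orP[/eqP->//|lt].
by rewrite /= nth_rcons size_inv_coefs lt IH.
Qed.

Lemma conv_invE p n : conv_inv p n =
  (p 0)^-1 * ((n == 0%N)%:R - \sum_(i < n) p (n - i)%N * conv_inv p i).
Proof.
rewrite /conv_inv /= nth_rcons size_inv_coefs ltnn eqxx; congr (_ * (_ - _)).
by apply: eq_bigr => i _; rewrite nth_inv_coefs.
Qed.

Lemma kinv_gt0 x : 0 < conv_inv (kcoef x) 0.
Proof. by rewrite conv_invE big_ord0 subr0 mulr1 invr_gt0 kcoef_gt0. Qed.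

Definition kinv x := @KPos (- kval x) (conv_inv (kcoef x)) (kinv_gt0 x).

Let tr p n : {poly R} := \poly_(i < n.+1) p i.

Lemma conv_poly p q n m : (n <= m)%N -> conv p q n = (tr p m * tr q m)`_n.
Proof.
move=> lnm; rewrite coefM; apply: eq_bigr => -[i /= li] _.
rewrite !coef_poly !ltnS (leq_trans _ lnm) ?(leq_trans (leq_subr _ _) lnm)//.
Qed.

Lemma convC p q : conv p q =1 conv q p.
Proof. by move=> n; rewrite !(@conv_poly _ _ n n)// mulrC. Qed.

Lemma convA p q r : conv p (conv q r) =1 conv (conv p q) r.
Proof.
move=> n; have -> : conv p (conv q r) n = (tr p n * (tr q n * tr r n))`_n.
  rewrite coefM; apply: eq_bigr => -[i /= li] _.
  by rewrite coef_poly li (@conv_poly _ _ _ n) ?leq_subr.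
rewrite mulrA coefM; apply: eq_bigr => -[i /= li] _.
rewrite (@conv_poly _ _ _ n)//; congr (_ * _).
by rewrite coef_poly ltnS leq_subr.
Qed.

Lemma convDr p q r : conv p (fun n => q n + r n) =1
  (fun n => conv p q n + conv p r n).
Proof.
by move=> n; rewrite /conv -big_split; apply: eq_bigr => i _; rewrite mulrDr.
Qed.

Lemma shiftE d p : shift d p =1 conv (fun n => (n == d)%:R) p.
Proof.
move=> n; rewrite /shift /conv; case: ltnP => lt.
  rewrite big1// => -[i /= li] _; case: eqP => [E|]; last by rewrite mul0r.
  by move: li; rewrite E ltnS leqNgt lt.
have ld : (d < n.+1)%N by [].
rewrite (bigD1 (Ordinal ld))//= eqxx mul1r big1 ?addr0// => i.
by rewrite -val_eqE /= => /negbTE->; rewrite mul0r.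
Qed.

Lemma conv_ext p p' q q' : p =1 p' -> q =1 q' -> conv p q =1 conv p' q'.
Proof. by move=> /funext-> /funext->. Qed.

Lemma conv_shift p d q : conv p (shift d q) =1 shift d (conv p q).
Proof.
move=> n; rewrite shiftE (conv_ext (frefl p) (@shiftE d q)) convA.
rewrite (conv_ext (convC _ _) (frefl q)) -convA.
by apply: conv_ext.
Qed.

(* The coefficient of t^i in x. *)
Definition kseries (x : Kpos_type) (i : int) : R :=
  if i < kval x then 0 else kcoef x `|i - kval x|%N.

Lemma kseries_inj x y : kseries x =1 kseries y -> x = y.
Proof.
move=> E; have le u v : kseries u =1 kseries v -> (kval v <= kval u).
  move=> /(_ (kval u)); rewrite /kseries ltxx subrr.
  by case: ltP => // _ E0; move: (kcoef_gt0 u); rewrite E0 ltxx.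
have ev : kval x = kval y by apply/le_anti; rewrite !le//.
apply: Kpos_eq => // n; have := E (kval x + n%:Z).
rewrite /kseries -ev ltNge lerDl le0z_nat /= addrAC subrr add0r.
by [].
Qed.

Lemma kseriesD x y i : kseries (kadd x y) i = kseries x i + kseries y i.
Proof.
have key (m : int) (z : Kpos_type) : m <= i -> m <= kval z ->
    shift `|kval z - m|%N (kcoef z) `|i - m|%N = kseries z i.
  move=> lmi lmz; rewrite /shift /kseries.
  have -> : (`|i - m| < `|kval z - m|)%N = (i < kval z).
    by rewrite -ltz_nat !gez0_abs ?subr_ge0// ltrD2r.
  case: ltP => // lzi; congr (kcoef z _); apply/eqP; rewrite -eqz_nat.
  rewrite -subzn; last by rewrite -lez_nat !gez0_abs ?subr_ge0// lerD2r.
  by rewrite !gez0_abs ?subr_ge0// opprB addrA subrK.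
rewrite {1}/kseries /=; case: ltP => [|lmi].
  by rewrite lt_min /kseries => /andP[-> ->]; rewrite addr0.
rewrite /kadd_coef /kdelta [Num.min (kval y) _]minC.
by rewrite !key// ge_min lexx ?orbT.
Qed.

Lemma kaddA : associative kadd.
Proof. by move=> x y z; apply: kseries_inj => i; rewrite !kseriesD addrA. Qed.

Lemma kaddC : commutative kadd.
Proof. by move=> x y; apply: kseries_inj => i; rewrite !kseriesD addrC. Qed.

Lemma kmulA : associative kmul.
Proof. by move=> x y z; apply: Kpos_eq => /=; [rewrite addrA|exact: convA]. Qed.

Lemma kmulC : commutative kmul.
Proof. by move=> x y; apply: Kpos_eq => /=; [rewrite addrC|exact: convC]. Qed.

Lemma kmul1 : left_id kone kmul.
Proof.
move=> x; apply: Kpos_eq => /= [|n]; first by rewrite add0r.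
by rewrite -shiftE /shift ltn0 subn0.
Qed.

Lemma kmulV : left_inverse kone kinv kmul.
Proof.
move=> x; apply: Kpos_eq => /= [|n]; first by rewrite addNr.
rewrite /conv big_ord_recr /= subnn [X in _ + X]mulrC conv_invE mulrA.
rewrite mulfV ?(gt_eqF (kcoef_gt0 x))// mul1r addrC.
by under [X in _ - X]eq_bigr do rewrite mulrC; rewrite subrK.
Qed.

Lemma kmulDr : right_distributive kmul kadd.
Proof.
move=> x y z; apply: Kpos_eq => /= [|n]; first by rewrite addr_minr.
have dE u v : kdelta (kmul x u) (kmul x v) = kdelta u v.
  by rewrite /kdelta /= -addr_minr opprD addrACA subrr add0r.
by rewrite convDr /kadd_coef !dE /= !conv_shift.
Qed.

Definition Kpos : semifield :=
  Semifield kaddA kaddC kmulA kmulC kmul1 kmulV kmulDr.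

Definition nval (x : Kpos) : Zt := - kval x.

End LaurentPositive.

Inductive sfexpr (I : Type) :=
| SVar of I
| SOne
| SAdd of sfexpr I & sfexpr I
| SMul of sfexpr I & sfexpr I
| SDiv of sfexpr I & sfexpr I.
Arguments SOne {I}.

Fixpoint seval (S : semifield) (I : Type) (x : I -> S) (e : sfexpr I) : S :=
  match e with
  | SVar i => x i
  | SOne => sf_one S
  | SAdd a b => sf_add (seval x a) (seval x b)
  | SMul a b => sf_mul (seval x a) (seval x b)
  | SDiv a b => sf_mul (seval x a) (sf_inv (seval x b))
  end.

(* A rational function on X is given by its values on a dense domain of
   definition (None elsewhere); two of them are identified when they agree
   wherever both are defined. *)
Definition ratfun (F X : Type) := X -> option F.

Definition rateq (F X : Type) (f g : ratfun F X) : Prop :=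
  forall P u v, f P = Some u -> g P = Some v -> u = v.

Definition opt2 (A : Type) (f : A -> A -> option A) (a b : option A) :=
  obind (fun u => obind (f u) b) a.

Fixpoint reval (F : fieldType) (X I : Type) (f : I -> ratfun F X)
    (e : sfexpr I) : ratfun F X := fun P =>
  match e with
  | SVar i => f i P
  | SOne => Some 1
  | SAdd a b => opt2 (fun u v => Some (u + v)) (reval f a P) (reval f b P)
  | SMul a b => opt2 (fun u v => Some (u * v)) (reval f a P) (reval f b P)
  | SDiv a b => opt2 (fun u v => if v == 0 then None else Some (u / v))
                  (reval f a P) (reval f b P)
  end.

Lemma reval_inv (F : fieldType) (X I : Type) (f : I -> ratfun F X) P Q e :
  (forall i, f i P = f i Q) -> reval f e P = reval f e Q.
Proof. by move=> E; elim: e => //= a -> b ->. Qed.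

(* A variety pv_pt / pv_eq with rational coordinate systems.  The transition
   functions are not data: they are the subtraction-free expressions e with
   rateq (pv_fun i) (reval pv_fun e), see sfpoint below. *)
Record posvar (F : fieldType) := PosVar {
  pv_pt : Type;
  pv_eq : pv_pt -> pv_pt -> Prop;
  pv_chart : Type;
  pv_crd : pv_chart -> finType;
  pv_fun : forall c, pv_crd c -> ratfun F pv_pt;
  pv_fun_inv : forall c (i : pv_crd c) P Q,
    pv_eq P Q -> pv_fun i P = pv_fun i Q
}.

Definition posfun (F : fieldType) (Y : posvar F) (c : pv_chart Y)
    (e : sfexpr (pv_crd c)) : ratfun F (pv_pt Y) :=
  reval (@pv_fun F Y c) e.

Record sfpoint (F : fieldType) (Y : posvar F) (S : semifield) := SfPoint {
  sfp :> forall c : pv_chart Y, pv_crd c -> S;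
  sfp_trans : forall c c' (i : pv_crd c') (e : sfexpr (pv_crd c)),
    rateq (pv_fun i) (posfun e) -> sfp i = seval (@sfp c) e
}.

Definition is_nval (R : realType) (F : fieldType) (Y : posvar F)
    (z : sfpoint Y (Kpos R)) (zt : sfpoint Y Zt) : Prop :=
  forall (c : pv_chart Y) (e : sfexpr (pv_crd c)),
    seval (@zt c) e = nval (seval (@z c) e).

Section PositiveMaps.
Variables (F : fieldType) (Y1 Y2 : posvar F) (h : pv_pt Y1 -> pv_pt Y2).

Definition is_pullback (c2 : pv_chart Y2) (g : sfexpr (pv_crd c2))
    (c1 : pv_chart Y1) (f : sfexpr (pv_crd c1)) : Prop :=
  rateq (fun P => posfun g (h P)) (posfun f).

Definition positive_map : Prop :=
  forall (c2 : pv_chart Y2) (g : sfexpr (pv_crd c2)),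
  exists (c1 : pv_chart Y1) (f : sfexpr (pv_crd c1)), is_pullback g f.

(* h(x) = y on S-points: g(y) = (h^* g)(x) for every positive g on Y2. *)
Definition maps_to (S : semifield) (x : sfpoint Y1 S) (y : sfpoint Y2 S) :=
  forall (c2 : pv_chart Y2) (g : sfexpr (pv_crd c2))
         (c1 : pv_chart Y1) (f : sfexpr (pv_crd c1)),
    is_pullback g f -> seval (@y c2) g = seval (@x c1) f.

Definition is_trop (ht : sfpoint Y1 Zt -> sfpoint Y2 Zt) : Prop :=
  forall x, maps_to x (ht x).

End PositiveMaps.

(* Seeds obtained from (B, coordinates) by mutation in mutable directions;
   cluster variables are written in the initial coordinates. *)
Section Mutation.
Variable I : finType.

Record seed := Seed { sd_B : I -> I -> int; sd_x : I -> sfexpr I }.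

Definition posp (z : int) : nat := if z is Posz n then n else 0%N.

Definition spow (e : sfexpr I) (n : nat) : sfexpr I := iter n (SMul e) SOne.

Definition mutate (s : seed) (j : I) : seed :=
  let: Seed B x := s in
  Seed
    (fun i l => if (i == j) || (l == j) then - B i l
       else B i l + (posp (B i j) * posp (B j l))%:Z
                  - (posp (- B i j) * posp (- B j l))%:Z)
    (fun i => if i == j then
         SDiv (SAdd (\big[@SMul I/SOne]_(l : I) spow (x l) (posp (B l j)))
                    (\big[@SMul I/SOne]_(l : I) spow (x l) (posp (- B l j))))
              (x j)
       else x i).

Definition mutations (B : I -> I -> int) (w : seq I) : seed :=
  foldl mutate (Seed B (@SVar I)) w.

End Mutation.

Section ClusterVariety.
Variables (F : fieldType) (X : Type) (eqX : X -> X -> Prop).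
Variables (T : Type) (I : T -> finType) (x : forall t, I t -> X -> F).
Variables (mut : forall t, pred (I t)) (B : forall t, I t -> I t -> int).
Hypothesis x_inv : forall t (i : I t) P Q, eqX P Q -> x i P = x i Q.

Definition cl_chart := {t : T & seq {j : I t | mut j}}.

Definition cl_fun (c : cl_chart) (i : I (projT1 c)) : ratfun F X :=
  reval (fun l P => Some (x l P))
    (sd_x (mutations (@B (projT1 c)) (map val (projT2 c))) i).

Lemma cl_fun_inv (c : cl_chart) (i : I (projT1 c)) P Q :
  eqX P Q -> cl_fun i P = cl_fun i Q.
Proof. by move=> E; apply: reval_inv => l; rewrite (x_inv l E). Qed.

Definition cluster_variety : posvar F :=
  @PosVar F X eqX cl_chart (fun c => I (projT1 c)) cl_fun cl_fun_inv.

End ClusterVariety.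

(* det (w_1, ..., w_k) for s = [:: w_1; ...; w_k]. *)
Definition detseq (F : fieldType) (k : nat) (s : seq 'rV[F]_k) : F :=
  \det (\matrix_(j < k) s`_j).

Lemma detseq_act (F : fieldType) k (s : seq 'rV[F]_k) (g : 'M[F]_k) :
  \det g = 1 -> detseq (map (mulmxr g) s) = detseq s.
Proof.
move=> g1; rewrite /detseq -[RHS]mulr1 -g1 -det_mulmx; congr (\det _).
apply/row_matrixP => j; rewrite row_mul !rowK.
have [lt|le] := ltnP j (size s); first by rewrite (nth_map 0).
by rewrite !nth_default ?size_map// mul0mx.
Qed.

Section ConfV.
Variables (F : fieldType) (k n : nat).

Definition vectors := 'I_n -> 'rV[F]_k.

Definition vectors_eq (v w : vectors) : Prop :=
  exists2 g : 'M[F]_k, \det g = 1 & forall p, w p = v p *m g.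

Definition plucker (J : {set 'I_n}) (v : vectors) : F :=
  detseq [seq v p | p <- enum J].

Lemma plucker_inv J v w : vectors_eq v w -> plucker J v = plucker J w.
Proof.
case=> g g1 E; rewrite /plucker -(detseq_act _ g1) -map_comp.
by congr detseq; apply: eq_map => p /=; rewrite E.
Qed.

(* With 0-based labels: {0, ..., a-1} u {i, ..., i+b-1} where b = k - a. *)
Definition seg (a i : nat) : {set 'I_n} :=
  [set j : 'I_n | (j < a)%N || (i <= j < i + (k - a))%N].

Definition is_seg (J : {set 'I_n}) : bool :=
  [exists a : 'I_k.+1, exists i : 'I_n.+1,
     [&& (a <= i)%N, (i + (k - a) <= n)%N & J == seg a i]].

Definition segs := {J : {set 'I_n} | is_seg J}.

Definition frozen_seg (J : segs) : bool :=
  [exists p : 'I_n,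
     val J == [set j : 'I_n | [exists l : 'I_k, j == ((p + l) %% n)%N :> nat]]].

(* Scott's quiver: the rectangles quiver on the (k - a) x (i - a) rectangles
   (a < i, a < k), together with the vertex seg k k = {0, ..., k-1} that plays
   the role of the empty rectangle. *)
Definition seg_arrow (J K : {set 'I_n}) : bool :=
  [exists a : 'I_k, exists i : 'I_n, (a < i)%N &&
     [|| (J == seg a i) && (K == seg a i.+1),
         [&& (a.+1 < k)%N, J == seg a.+1 i.+1 & K == seg a i] |
         [&& (a.+1 < k)%N, (a.+1 < i)%N, J == seg a i & K == seg a.+1 i]]]
  || (J == seg k k) && (K == seg k.-1 k).

Definition seg_B (J K : segs) : int :=
  (seg_arrow (val J) (val K))%:Z - (seg_arrow (val K) (val J))%:Z.

Definition ConfV : posvar F :=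
  @cluster_variety F vectors vectors_eq unit (fun=> segs)
    (fun _ J => plucker (val J)) (fun=> predC frozen_seg) (fun=> seg_B)
    (fun _ J v w E => plucker_inv (val J) E).

End ConfV.

Section ConfA.
Variables (F : fieldType) (k n : nat).

(* The rows of M are the vectors v_1, ..., v_k of the basis. *)
Definition basis := {M : 'M[F]_k | \det M == 1}.

Definition vecs (M : 'M[F]_k) : seq 'rV[F]_k := [seq row i M | i : 'I_k].

Definition unipotent (u : 'M[F]_k) : bool :=
  is_trig_mx u && [forall i, u i i == 1].

Definition flags := 'I_n -> basis.

(* Equality in G \ (G/U)^n: each basis is changed by an element of U, and the
   whole configuration by an element of G. *)
Definition flags_eq (P Q : flags) : Prop :=
  exists2 g : 'M[F]_k, \det g = 1 &
  exists2 u : 'I_n -> 'M[F]_k, (forall p, unipotent (u p)) &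
  forall p, val (Q p) = u p *m val (P p) *m g.

(* det of the first m_p vectors of the p-th flag, for p = 0, ..., n-1. *)
Definition flag_minor (m : 'I_n -> nat) (P : flags) : F :=
  detseq (flatten [seq take (m p) (vecs (val (P p))) | p : 'I_n]).

Definition urel (s s' : seq 'rV[F]_k) : Prop :=
  size s = size s' /\
  forall j, exists c : nat -> F, s'`_j = s`_j + \sum_(l < j) c l *: s`_l.

Lemma urel_det s s' : urel s s' -> detseq s = detseq s'.
Proof.
case=> _ /choice[c cE].
pose L : 'M[F]_k := \matrix_(j, l) if (l < j)%N then c j l else (j == l)%:R.
have LE : \det L = 1.
  rewrite det_trig; first by rewrite big1// => j _; rewrite mxE ltnn eqxx.
  apply/is_trig_mxP => i j lij; rewrite mxE ltnNge (ltnW lij) /=.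
  by rewrite -val_eqE (ltn_eqF lij).
rewrite /detseq -[LHS]mul1r -LE -det_mulmx; congr (\det _).
apply/row_matrixP => j; rewrite rowK cE; apply/rowP => z; rewrite !mxE.
rewrite (bigD1 j)//= !mxE ltnn eqxx mul1r; congr (_ + _).
rewrite summxE (big_ord_widen k (fun l => (c j l *: s`_l) 0 z)) ?(ltnW (ltn_ord j))//.
rewrite [RHS]big_mkcond [LHS]big_mkcond.
apply: eq_bigr => l _; rewrite !mxE.
case: (ltngtP l j) => [lj|lj|/val_inj->]; last by rewrite eqxx.
  by rewrite -val_eqE /= (ltn_eqF lj).
by rewrite -!val_eqE /= (gtn_eqF lj) (ltn_eqF lj) mul0r.
Qed.

Lemma urel_cat s1 s1' s2 s2' :
  urel s1 s1' -> urel s2 s2' -> urel (s1 ++ s2) (s1' ++ s2').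
Proof.
move=> [z1 r1] [z2 r2]; split=> [|j]; first by rewrite !size_cat z1 z2.
rewrite !nth_cat -z1; case: ltnP => lj.
  have [c cE] := r1 j; exists c; rewrite cE; congr (_ + _).
  by apply: eq_bigr => l _; rewrite nth_cat (ltn_trans _ lj).
have [c cE] := r2 (j - size s1)%N.
pose d l := if (l < size s1)%N then 0 else c (l - size s1)%N.
exists d; rewrite cE; congr (_ + _).
rewrite -(big_mkord xpredT (fun l => c l *: s2`_l)).
rewrite -(big_mkord xpredT (fun l => d l *: (s1 ++ s2)`_l)).
rewrite [RHS](big_cat_nat (n := size s1))//= [X in _ = X + _]big1_seq ?add0r.
  rewrite -{2}[size s1]add0n big_addn; apply: eq_bigr => l _.
  by rewrite /d nth_cat !ltnNge leq_addl /= addnK.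
by move=> l; rewrite mem_index_iota /d /= => ->; rewrite scale0r.
Qed.

Lemma urel_take (u M : 'M[F]_k) d :
  unipotent u -> urel (take d (vecs M)) (take d (vecs (u *m M))).
Proof.
move=> /andP[/is_trig_mxP ut /forallP u1].
have sz N : size (vecs N) = k by rewrite size_map size_enum_ord.
split=> [|j]; first by rewrite !size_take !sz.
have [ld|ld] := ltnP j (minn d k); last first.
  exists (fun=> 0); rewrite !nth_default ?size_take_min ?sz// big1 ?addr0//.
  by move=> l _; rewrite scale0r.
move: ld; rewrite leq_min => /andP[ld lk]; pose i := Ordinal lk.
have nE N (l : 'I_k) : (l < d)%N -> (take d (vecs N))`_l = row l N.
  by move=> ll; rewrite nth_take// (nth_map l) ?size_enum_ord// nth_ord_enum.
exists (fun l => if insub l is Some l' then u i l' else 0).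
rewrite -[j]/(val i) !nE//= row_mul.
rewrite mulmx_sum_row (bigD1 i)//= mxE (eqP (u1 i)) scale1r; congr (_ + _).
rewrite (big_ord_widen k (fun l => (if insub l is Some l' then u i l' else 0)
  *: (take d (vecs M))`_l) (ltnW lk)).
rewrite [RHS]big_mkcond [LHS]big_mkcond /=; apply: eq_bigr => l _.
rewrite valK mxE; case: (ltngtP l j) => [lj|lj|lj].
- by rewrite -val_eqE /= (ltn_eqF lj) nE// (ltn_trans lj).
- by rewrite -val_eqE /= (gtn_eqF lj) ut// scale0r.
- by rewrite -val_eqE /= lj eqxx.
Qed.

Lemma flag_minor_inv m P Q : flags_eq P Q -> flag_minor m P = flag_minor m Q.
Proof.
case=> g g1 [u uU E]; rewrite /flag_minor.
transitivity (detseq (flatten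
    [seq take (m p) (vecs (u p *m val (P p))) | p : 'I_n])).
  apply: urel_det; rewrite /image_mem; elim: (enum _) => [|p s IH] /=.
    by split=> // j; exists (fun=> 0); rewrite big1 ?addr0// => l _;
       rewrite scale0r.
  by apply: urel_cat => //; exact: urel_take.
rewrite -(detseq_act _ g1) map_flatten -map_comp; congr (detseq (flatten _)).
apply: eq_map => p /=; rewrite map_take E; congr take.
by rewrite /vecs -map_comp; apply: eq_map => i /=; rewrite [RHS]row_mul.
Qed.

(* Chords p < q of the convex polygon with vertices 0, ..., n-1 (sides
   included); a triangulation is a maximal set of non-crossing chords. *)
Definition crossing (d e : 'I_n * 'I_n) : bool :=
  (d.1 < e.1 < d.2)%N && (d.2 < e.2)%N || (e.1 < d.1 < e.2)%N && (e.2 < d.2)%N.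

Definition is_triangulation (E : {set 'I_n * 'I_n}) : bool :=
  [&& [forall d in E, (d.1 < d.2)%N],
      [forall d in E, forall e in E, ~~ crossing d e] &
      [forall d : 'I_n * 'I_n, (d.1 < d.2)%N ==>
         [forall e in E, ~~ crossing d e] ==> (d \in E)]].

Definition triangulation := {E : {set 'I_n * 'I_n} | is_triangulation E}.

Definition triangle (E : {set 'I_n * 'I_n}) (p q r : 'I_n) : bool :=
  [&& (p < q < r)%N, (p, q) \in E, (q, r) \in E & (p, r) \in E].

Definition supported (m : 'I_n -> nat) (s : seq 'I_n) : bool :=
  [forall p, (m p != 0%N) ==> (p \in s)].

(* The exponents (i_1, i_2, i_3) at the vertices of some triangle, i_j < k. *)
Definition is_exponent (E : triangulation) (m : {ffun 'I_n -> 'I_k}) : bool :=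
  (\sum_p m p == k)%N &&
  [exists p, exists q, exists r,
     triangle (val E) p q r && supported (fun x => m x : nat) [:: p; q; r]].

Definition exponents (E : triangulation) :=
  {m : {ffun 'I_n -> 'I_k} | is_exponent E m}.

Definition expt (E : triangulation) (m : exponents E) (p : 'I_n) : nat :=
  val m p.

(* Coordinates on the sides of the polygon. *)
Definition frozen_exponent (E : triangulation) (m : exponents E) : bool :=
  [exists p : 'I_n, [forall q : 'I_n, (expt m q != 0%N) ==>
     ((q == p) || (q == (p.+1 %% n)%N :> nat))]].

(* m' = m - e_p + e_q *)
Definition step (m m' : 'I_n -> nat) (p q : 'I_n) : bool :=
  [forall r, (m' r + (r == p) == m r + (r == q))%N].

(* The k-triangulation quiver: arrows m0+e_p -> m0+e_q -> m0+e_r -> m0+e_p in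
   each triangle p < q < r; those on a diagonal cancel. *)
Definition exp_B (E : triangulation) (m m' : exponents E) : int :=
  \sum_p \sum_q \sum_(r | triangle (val E) p q r &&
      (supported (expt m) [:: p; q; r] && supported (expt m') [:: p; q; r]))
    \sum_(d <- [:: (p, q); (q, r); (r, p)])
      ((step (expt m) (expt m') d.1 d.2)%:Z - (step (expt m') (expt m) d.1 d.2)%:Z).

Definition ConfA : posvar F :=
  @cluster_variety F flags flags_eq triangulation exponents
    (fun _ m => flag_minor (expt m)) (fun E => predC (@frozen_exponent E)) exp_B
    (fun _ m P Q E => flag_minor_inv (expt m) E).

Definition first_vectors (P : flags) : vectors F k n :=
  fun p => head 0 (vecs (val (P p))).

Lemma first_vectors_eq P Q :
  flags_eq P Q -> vectors_eq (first_vectors P) (first_vectors Q).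
Proof.
case=> g g1 [u uU E]; exists g => // p; rewrite /first_vectors E -!nth0.
have [k0|k1] := posnP k.
  by rewrite !nth_default ?mul0mx// size_map size_enum_ord k0.
have [_ /(_ 0%N)[c]] := urel_take (val (P p)) 1 (uU p).
rewrite !nth_take// big_ord0 addr0 => <-.
have nE N : (vecs N)`_0 = row (Ordinal k1) N.
  by rewrite (nth_map (Ordinal k1)) ?size_enum_ord// (nth_ord_enum _ (Ordinal k1)).
by rewrite !nE row_mul.
Qed.

Definition conf_pi : pv_pt ConfA -> pv_pt (ConfV F k n) := first_vectors.

End ConfA.

(* Main.v *)
Require Import Defs.
From HB Require Import structures.
From mathcomp Require Import all_boot all_order all_algebra.
From mathcomp Require Import perm.
From mathcomp Require Import boolp reals complex.
From mathcomp Require Import zify ring.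

Set Implicit Arguments.
Unset Strict Implicit.
Unset Printing Implicit Defensive.

Import Order.TTheory GRing.Theory Num.Theory.
Local Open Scope ring_scope.

(* The map to first vectors has a subtraction-free section. Given vectors with
   positive Pluecker coordinates, insert a vector w next to v_p, of the form
   w = v_p - eps_1 (v_{p-1} - eps_2 (v_{p-2} - ...)); choosing the eps_i as
   subtraction-free functions of the Pluecker coordinates makes all maximal
   minors of the longer list subtraction-free. Repeating this k - 1 times at each
   p completes the v_p to flags with positive minors. Two subtraction-free
   expressions that agree on positive reals agree in every semifield, so the
   section makes pi surjective on points over every semifield: over Z^t this is
   the surjectivity of pi^t, and over K_{>0} it gives the lift x of y.
   Three-term Pluecker relations express all flag minors, in particular the
   pullbacks of Pluecker coordinates, subtraction-freely in the chart of any
   triangulation, so pi is a positive map and pi^t is well defined. *)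

(** * Subtraction-free identities *)

(** A point over a semifield must respect every subtraction-free relation between coordinates of any
    two clusters, and these relations are given only as identities of partial rational functions.
    They are therefore tested on actual complex configurations with positive real cluster
    coordinates: every expression is defined there, and an identity valid for all positive
    parameters transfers to every semifield. This requires a family of configurations in which the
    chart coordinates of the vectors take arbitrary positive values, so the vectors themselves must
    first be built from prescribed minors. In that construction an epsilon that is merely small
    enough is useless, because it has to make sense over every semifield; it must be a
    subtraction-free function. The entries of the vectors cannot all be subtraction-free, so they
    are kept as differences, and only the maximal minors are shown to be subtraction-free. Inserting
    vectors after [v_p] is reduced to appending at the end of the list by a signed cyclic rotation,
    which preserves positivity of the maximal minors. *)

Definition zsf (S : semifield) : Type := option S.

HB.instance Definition _ (S : semifield) := gen_eqMixin (zsf S).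
HB.instance Definition _ (S : semifield) := gen_choiceMixin (zsf S).

Section ZeroAdjoined.
Variable S : semifield.
Implicit Types a b c : zsf S.

Definition zsf_add a b : zsf S :=
  match a, b with
  | Some u, Some v => Some (sf_add u v)
  | None, _ => b
  | _, None => a
  end.

Definition zsf_mul a b : zsf S :=
  match a, b with Some u, Some v => Some (sf_mul u v) | _, _ => None end.

Lemma zsf_addA : associative zsf_add.
Proof. by move=> [u|] [v|] [w|] //=; rewrite sf_addA. Qed.

Lemma zsf_addC : commutative zsf_add.
Proof. by move=> [u|] [v|] //=; rewrite sf_addC. Qed.

Lemma zsf_add0 : left_id None zsf_add.
Proof. by case. Qed.

Lemma zsf_mulA : associative zsf_mul.
Proof. by move=> [u|] [v|] [w|] //=; rewrite sf_mulA. Qed.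

Lemma zsf_mulC : commutative zsf_mul.
Proof. by move=> [u|] [v|] //=; rewrite sf_mulC. Qed.

Lemma zsf_mul1 : left_id (Some (sf_one S)) zsf_mul.
Proof. by move=> [u|] //=; rewrite sf_mul1. Qed.

Lemma zsf_mulDl : left_distributive zsf_mul zsf_add.
Proof.
by move=> [u|] [v|] [w|] //=; rewrite sf_mulC sf_mulDr !(sf_mulC w).
Qed.

Lemma zsf_mul0 : left_zero None zsf_mul.
Proof. by []. Qed.

HB.instance Definition _ :=
  GRing.isNmodule.Build (zsf S) zsf_addA zsf_addC zsf_add0.

Lemma zsf_1_neq0 : Some (sf_one S) != 0 :> zsf S.
Proof. by apply/eqP. Qed.

(** With a zero adjoined, [S] becomes a commutative semiring in which polynomials with natural
    coefficients can be evaluated; nonzero factors can still be cancelled ([zsf_mulI]). *)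
HB.instance Definition _ := GRing.Nmodule_isComNzSemiRing.Build (zsf S)
  zsf_mulA zsf_mulC zsf_mul1 zsf_mulDl zsf_mul0 zsf_1_neq0.

Lemma zsf_mulI (u v w : S) :
  (Some u : zsf S) * Some w = (Some v : zsf S) * Some w -> u = v.
Proof.
have K (z : S) : z = sf_mul (sf_mul z w) (sf_inv w).
  by rewrite -sf_mulA (sf_mulC w) sf_mulV sf_mulC sf_mul1.
by case=> E; rewrite (K u) E -K.
Qed.

End ZeroAdjoined.

(** * Polynomials with natural coefficients *)

Section PositivePolynomials.
Variable I : finType.
Implicit Types (m : {ffun I -> nat}) (s t : seq {ffun I -> nat}).

Definition mone : {ffun I -> nat} := [ffun=> 0%N].
Definition mvar (i : I) : {ffun I -> nat} := [ffun j => (j == i : nat)].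
Definition madd (m m' : {ffun I -> nat}) : {ffun I -> nat} :=
  [ffun i => (m i + m' i)%N].
Definition pmul s t := [seq madd m m' | m <- s, m' <- t].

(** A list of monomials encodes a polynomial: the coefficient of a monomial is its multiplicity in
    the list. *)
Definition peval (A : comNzSemiRingType) (x : I -> A) s : A :=
  \sum_(m <- s) \prod_i x i ^+ m i.

(** Fractions are never reduced, so both lists stay nonempty and no subtraction enters. *)
Fixpoint sfnum (e : sfexpr I) : seq {ffun I -> nat} :=
  match e with
  | SVar i => [:: mvar i]
  | SOne => [:: mone]
  | SAdd a b => pmul (sfnum a) (sfden b) ++ pmul (sfnum b) (sfden a)
  | SMul a b => pmul (sfnum a) (sfnum b)
  | SDiv a b => pmul (sfnum a) (sfden b)
  end
with sfden (e : sfexpr I) : seq {ffun I -> nat} :=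
  match e with
  | SVar i => [:: mone]
  | SOne => [:: mone]
  | SAdd a b => pmul (sfden a) (sfden b)
  | SMul a b => pmul (sfden a) (sfden b)
  | SDiv a b => pmul (sfden a) (sfnum b)
  end.

Lemma pmul_neq0 s t : s != [::] -> t != [::] -> pmul s t != [::].
Proof. by case: s => // m s _; case: t. Qed.

Lemma sfnum_den_neq0 e : (sfnum e != [::]) /\ (sfden e != [::]).
Proof.
elim: e => //= a [na da] b [nb db]; rewrite ?pmul_neq0//; split=> //.
by case: (pmul _ _) (pmul_neq0 na db).
Qed.

Section Eval.
Variables (A : comNzSemiRingType) (x : I -> A).

Lemma peval_cat s t : peval x (s ++ t) = peval x s + peval x t.
Proof. by rewrite /peval big_cat. Qed.

Lemma peval_mul s t : peval x (pmul s t) = peval x s * peval x t.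
Proof.
rewrite /peval big_distrlr /pmul big_allpairs_dep /=.
apply: eq_bigr => m _; apply: eq_bigr => m' _; rewrite -big_split.
by apply: eq_bigr => i _; rewrite ffunE exprD.
Qed.

Lemma peval_one : peval x [:: mone] = 1.
Proof. by rewrite /peval big_seq1 big1// => i _; rewrite ffunE. Qed.

Lemma peval_var i : peval x [:: mvar i] = x i.
Proof.
rewrite /peval big_seq1 (bigD1 i)//= big1 ?ffunE ?eqxx ?mulr1// => j ne.
by rewrite ffunE (negbTE ne).
Qed.

Lemma peval_perm s t : perm_eq s t -> peval x s = peval x t.
Proof. by move=> p; rewrite /peval (perm_big _ p). Qed.

End Eval.

(** With the denominator cleared, the relation makes sense in a semiring without division; it is
    applied both to the reals and to [zsf S]. *)
Lemma seval_frac (S : semifield) (A : comNzSemiRingType) (f : S -> A) :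
  {morph f : a b / sf_add a b >-> a + b} ->
  {morph f : a b / sf_mul a b >-> a * b} -> f (sf_one S) = 1 ->
  forall (x : I -> S) e,
    f (seval x e) * peval (f \o x) (sfden e) = peval (f \o x) (sfnum e).
Proof.
move=> fD fM f1 x; set P := peval (f \o x).
have fV u : f u * f (sf_inv u) = 1 by rewrite -fM sf_mulC sf_mulV.
elim=> [i||a IHa b IHb|a IHa b IHb|a IHa b IHb] /=.
- by rewrite /P peval_one peval_var mulr1.
- by rewrite /P peval_one f1 mulr1.
- rewrite fD /P peval_cat !peval_mul -/P -IHa -IHb mulrDl !mulrA; congr (_ + _).
  by rewrite -!mulrA [P (sfden a) * _]mulrC.
- by rewrite fM /P !peval_mul -/P -IHa -IHb mulrACA.
- rewrite fM /P !peval_mul -/P -IHa -IHb mulrACA; congr (_ * _).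
  by rewrite mulrA [f (sf_inv _) * _]mulrC fV mul1r.
Qed.

(** A nonempty sum of nonzero elements is nonzero, since adding to [Some u] never gives [None]. *)
Lemma peval_zsf (S : semifield) (x : I -> S) s : s != [::] ->
  exists u, peval (fun i => Some (x i) : zsf S) s = Some u.
Proof.
case: s => // m s _; rewrite /peval big_cons.
have [u ->] : exists u, \prod_i (Some (x i) : zsf S) ^+ m i = Some u.
  elim/big_rec: _ => [|i _ _ [u ->]]; first by exists (sf_one S).
  have [v ->] : exists v, (Some (x i) : zsf S) ^+ m i = Some v.
    elim: (m i) => [|d [v E]]; first by exists (sf_one S).
    by exists (sf_mul (x i) v); rewrite exprS E.
  by exists (sf_mul v u).
case: (\sum_(_ <- s) _) => [v|]; first by exists (sf_add u v).
by exists u; rewrite addr0.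
Qed.

Lemma digits_inj N B (d d' : nat -> nat) :
  (forall i, d i < B)%N -> (forall i, d' i < B)%N ->
  (\sum_(i < N) d i * B ^ i = \sum_(i < N) d' i * B ^ i)%N ->
  forall i, (i < N)%N -> d i = d' i.
Proof.
elim: N d d' => // N IH d d' dB d'B.
rewrite !big_ord_recl !expn0 !muln1 => E.
have F (e : nat -> nat) : (\sum_(i < N) e (bump 0 i) * B ^ bump 0 i =
    B * \sum_(i < N) e i.+1 * B ^ i)%N.
  by rewrite big_distrr; apply: eq_bigr => i _; rewrite /bump add1n expnS mulnCA.
rewrite !F in E; have B0 : (0 < B)%N by apply: leq_ltn_trans (dB 0%N).
have E0 : d 0%N = d' 0%N.
  have /(congr1 (modn^~ B)) := E.
  by rewrite ![(B * _)%N]mulnC ![(d _ + _)%N]addnC ![(d' _ + _)%N]addnC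
    !modnMDl !modn_small.
case=> [//|i]; rewrite ltnS; apply: (IH (d \o S) (d' \o S)) => [j|j|] //=.
by apply/eqP; rewrite -(eqn_pmul2l B0) -(eqn_add2l (d 0%N)) E E0.
Qed.

(* Kronecker substitution: [x_i := u ^ (B ^ i)] with [B] above all exponents. *)
Lemma peval_inj (R : numFieldType) s t :
  (forall x : I -> R, (forall i, 0 < x i) -> peval x s = peval x t) ->
  perm_eq s t.
Proof.
move=> E; pose B := (\max_(m <- s ++ t) \max_i m i).+1%N.
pose code m := (\sum_i m i * B ^ enum_rank i)%N.
have lt m i : m \in s ++ t -> (m i < B)%N.
  move=> ms; rewrite ltnS. apply: leq_trans (leq_bigmax (F := m) i) _.
  exact: (leq_bigmax_seq (F := fun m : {ffun I -> nat} => \max_i m i)%N).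
have code_inj : {in s ++ t &, injective code}.
  move=> m m' ms m's; pose d (m : {ffun I -> nat}) j :=
    if insub j is Some j' then m (enum_val (j' : 'I_#|I|)) else 0%N.
  have codeE m0 : code m0 = (\sum_(j < #|I|) d m0 j * B ^ j)%N.
    rewrite /code (reindex _ (onW_bij _ (@enum_val_bij I))) /=.
    by apply: eq_bigr => j _; rewrite enum_valK /d valK.
  rewrite !codeE => /digits_inj-H; apply/ffunP => i.
  have dB m0 : m0 \in s ++ t -> forall j, (d m0 j < B)%N.
    by move=> m0s j; rewrite /d; case: insub => // j'; exact: lt.
  have := H (dB _ ms) (dB _ m's) (enum_rank i) (ltn_ord _).
  by rewrite /d !valK !enum_rankK.
pose Q (w : seq {ffun I -> nat}) : {poly R} := \sum_(m <- w) 'X^(code m).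
have QE w u : (Q w).[u] = peval (fun i => u ^+ (B ^ enum_rank i)) w.
  rewrite /Q horner_sum; apply: eq_bigr => m _; rewrite hornerXn /code expr_sum.
  by apply: eq_bigr => i _; rewrite mulnC exprM.
have QQ : Q s = Q t.
  apply/eqP; rewrite -subr_eq0; apply/eqP.
  (* The difference vanishes at 1, 2, 3, ..., and taking as many of these points as the size of the
     polynomial exceeds its degree. *)
  pose r := [seq (i.+1)%:R | i <- iota 0 (size (Q s - Q t))] : seq R.
  apply: (@roots_geq_poly_eq0 _ _ r); last by rewrite size_map size_iota.
    apply/allP => _ /mapP[i _ ->]; rewrite rootE hornerD hornerN !QE E ?subrr//.
    by move=> j; rewrite exprn_gt0 ?ltr0Sn.
  rewrite map_inj_uniq ?iota_uniq// => i j /eqP.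
  by rewrite eqr_nat eqSS => /eqP.
have Qc w c : (Q w)`_c = (count_mem c (map code w))%:R.
  rewrite /Q coef_sum; elim: w => [|m w IH] /=; first by rewrite big_nil.
  by rewrite big_cons IH coefXn natrD eq_sym.
apply/allP => m ms /=; apply/eqP.
have cE w : {subset w <= s ++ t} ->
    count_mem m w = count_mem (code m) (map code w).
  move=> sub; rewrite count_map; apply: eq_in_count => m' m'w /=.
  by apply/eqP/eqP => [->//|]; apply: code_inj => //; exact: sub.
rewrite !cE => [|z|z]; try by rewrite mem_cat => ->; rewrite ?orbT.
by apply/eqP; rewrite -(eqr_nat R) -!Qc QQ.
Qed.

End PositivePolynomials.

(** * The semifield of positive reals and the transfer of identities *)

Section PositiveReals.
Variable R : realType.

Definition rpos := {x : R | 0 < x}.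

Definition rp_mk (x : R) (x0 : 0 < x) : rpos := exist _ x x0.
Definition rp_add (x y : rpos) : rpos := @rp_mk _ (addr_gt0 (valP x) (valP y)).
Definition rp_mul (x y : rpos) : rpos := @rp_mk _ (mulr_gt0 (valP x) (valP y)).
Definition rp_one : rpos := rp_mk ltr01.

Lemma rp_inv_gt0 (x : rpos) : 0 < (val x)^-1.
Proof. by rewrite invr_gt0 (valP x). Qed.

Definition rp_inv (x : rpos) : rpos := @rp_mk _ (rp_inv_gt0 x).

Lemma rp_addA : associative rp_add.
Proof. by move=> x y z; apply/val_inj; rewrite /= addrA. Qed.

Lemma rp_addC : commutative rp_add.
Proof. by move=> x y; apply/val_inj; rewrite /= addrC. Qed.

Lemma rp_mulA : associative rp_mul.
Proof. by move=> x y z; apply/val_inj; rewrite /= mulrA. Qed.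

Lemma rp_mulC : commutative rp_mul.
Proof. by move=> x y; apply/val_inj; rewrite /= mulrC. Qed.

Lemma rp_mul1 : left_id rp_one rp_mul.
Proof. by move=> x; apply/val_inj; rewrite /= mul1r. Qed.

Lemma rp_mulV : left_inverse rp_one rp_inv rp_mul.
Proof. by move=> x; apply/val_inj; rewrite /= mulVf ?gt_eqF ?(valP x). Qed.

Lemma rp_mulDr : right_distributive rp_mul rp_add.
Proof. by move=> x y z; apply/val_inj; rewrite /= mulrDr. Qed.

Definition Rpos : semifield :=
  Semifield rp_addA rp_addC rp_mulA rp_mulC rp_mul1 rp_mulV rp_mulDr.

(* A name for the carrier that simplification does not unfold. *)
Definition rpt : Type := Rpos.
Arguments rpt : simpl never.

Definition rpval (x : Rpos) : R := val (x : rpos).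

Lemma rpval_gt0 x : 0 < rpval x.
Proof. exact: valP. Qed.

(* The cross products of numerators and denominators agree as multisets of
   monomials, and so have the same value in every semifield. *)
Lemma seval_transfer (I : finType) (e e' : sfexpr I) :
  (forall y : I -> Rpos, seval y e = seval y e') ->
  forall (S : semifield) (y : I -> S), seval y e = seval y e'.
Proof.
move=> E S y.
have p : perm_eq (pmul (sfnum e) (sfden e')) (pmul (sfnum e') (sfden e)).
  apply: (@peval_inj _ R) => x x0; rewrite !peval_mul.
  pose z i : Rpos := rp_mk (x0 i).
  have F := @seval_frac I Rpos R rpval (fun _ _ => erefl) (fun _ _ => erefl)
    erefl z.
  by rewrite -[x]/(rpval \o z) -!F E mulrAC.
have F := @seval_frac I S (zsf S) (@Some S) (fun _ _ => erefl)
  (fun _ _ => erefl) erefl y.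
have [[_ d0] [_ d0']] := (sfnum_den_neq0 e, sfnum_den_neq0 e').
have [u uE] := peval_zsf y d0; have [v vE] := peval_zsf y d0'.
(* Multiply by both denominators, whose values [u] and [v] are nonzero. *)
apply: (@zsf_mulI S _ _ (sf_mul u v)).
have -> : (Some (sf_mul u v) : zsf S) = (Some u : zsf S) * Some v by [].
have := peval_perm (fun i => Some (y i) : zsf S) p.
rewrite !peval_mul -!F /comp uE vE => G.
by rewrite mulrA G -mulrA [X in _ * X]mulrC.
Qed.

End PositiveReals.

(** * Determinants of lists of vectors *)

Section DetSeq.
Variables (F : fieldType) (k : nat).
Implicit Types (A B C D E T s : seq 'rV[F]_k) (x y p q r : 'rV[F]_k).

Let mx s : 'M[F]_k := \matrix_(j < k) s`_j.

(** Cofactors along row [i] do not see row [i], so they can be computed from any list agreeing with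
    [s] elsewhere. Linearity and Cramer's rule both follow from this. *)
Lemma detseq_expand s s' (i : 'I_k) :
  (forall j : nat, j != i -> s`_j = s'`_j) ->
  detseq s = \sum_j s`_i 0 j * cofactor (mx s') i j.
Proof.
move=> E; rewrite /detseq (expand_det_row _ i); apply: eq_bigr => j _.
rewrite mxE; congr (_ * (_ * \det _)).
by apply/matrixP => a b; rewrite !mxE E// eq_sym neq_lift.
Qed.

Lemma detseq_linear A B : (size A < k)%N ->
  exists c : 'cV[F]_k, forall x, detseq (A ++ x :: B) = (x *m c) 0 0.
Proof.
move=> lt; pose i := Ordinal lt.
exists (\col_j cofactor (mx (A ++ 0 :: B)) i j) => x.
rewrite (@detseq_expand _ (A ++ 0 :: B) i) => [|j ji].
  by rewrite mxE; apply: eq_bigr => j _; rewrite !mxE nth_cat ltnn subnn.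
rewrite !nth_cat; case: ltnP => // le.
by case E: (j - size A)%N => [|d] //; case/negP: ji; rewrite eqn_leq le -subn_eq0 E.
Qed.

Lemma detseqD A B x y : (size A < k)%N ->
  detseq (A ++ (x + y) :: B) = detseq (A ++ x :: B) + detseq (A ++ y :: B).
Proof. by case/(detseq_linear B) => c E; rewrite !E mulmxDl mxE. Qed.

Lemma detseqZ A B a x : (size A < k)%N ->
  detseq (A ++ (a *: x) :: B) = a * detseq (A ++ x :: B).
Proof. by case/(detseq_linear B) => c E; rewrite !E -scalemxAl mxE. Qed.

Lemma detseq_dup A B C x : ((size A + size B).+1 < k)%N ->
  detseq (A ++ x :: B ++ x :: C) = 0.
Proof.
move=> lt; have lt' : (size A < k)%N by lia.
apply: (determinant_alternate (i1 := Ordinal lt') (i2 := Ordinal lt)) => [|j].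
  by apply/eqP => /(congr1 val) /=; lia.
rewrite !mxE /= !nth_cat ltnn subnn /=.
by rewrite ltnNge leqW ?leq_addr//= subSn ?leq_addr//= addKn nth_cat ltnn subnn.
Qed.

Lemma detseq_swap A B x y : ((size A).+1 < k)%N ->
  detseq (A ++ x :: y :: B) = - detseq (A ++ y :: x :: B).
Proof.
move=> lt; have lt0 : (size A < k)%N by exact: ltnW.
have dup z : detseq (A ++ z :: z :: B) = 0.
  by apply: (@detseq_dup A [::] B z); rewrite addn0.
have D2 u v w : detseq (A ++ w :: (u + v) :: B) =
    detseq (A ++ w :: u :: B) + detseq (A ++ w :: v :: B).
  by have := @detseqD (rcons A w) B u v; rewrite size_rcons !cat_rcons; exact.
apply/eqP; rewrite -addr_eq0 -(dup (x + y)) detseqD// !D2 !dup.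
by rewrite add0r addr0.
Qed.

Lemma detseq_move A B C x : (size A + size B < k)%N ->
  detseq (A ++ x :: B ++ C) = (-1) ^+ size B * detseq (A ++ B ++ x :: C).
Proof.
elim: B A => [|y B IH] A /= lt; first by rewrite mul1r.
rewrite detseq_swap; last by lia.
rewrite -cat_rcons IH ?size_rcons; last by lia.
by rewrite exprS mulN1r mulNr cat_rcons.
Qed.

Lemma cramer s x (lt : size s = k) :
  detseq s *: x = \sum_(i < k) detseq (set_nth 0 s i x) *: s`_i.
Proof.
have -> : detseq s *: x = x *m \adj (mx s) *m mx s.
  by rewrite -mulmxA mul_adj_mx mul_mx_scalar.
rewrite mulmx_sum_row; apply: eq_bigr => i _; rewrite rowK; congr (_ *: _).
rewrite (@detseq_expand _ s i) => [|j ji].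
  rewrite mxE; apply: eq_bigr => j _.
  by rewrite !mxE nth_set_nth /= eqxx.
by rewrite nth_set_nth /= (negbTE ji).
Qed.

(* Expand [b] in [T, a, c] by Cramer's rule and apply [det (T, _, d)]. *)
Lemma pluecker_tail T a b c d : (size T).+2 = k ->
  detseq (T ++ [:: a; c]) * detseq (T ++ [:: b; d]) =
  detseq (T ++ [:: a; b]) * detseq (T ++ [:: c; d]) +
  detseq (T ++ [:: a; d]) * detseq (T ++ [:: b; c]).
Proof.
move=> kE; have lt : (size T < k)%N by lia.
have [w wE] := detseq_linear [:: d] lt.
have := @cramer (T ++ [:: a; c]) b; rewrite size_cat addn2 => /(_ kE).
move=> /(congr1 (fun z => (z *m w) 0 0)); rewrite -scalemxAl mxE -wE => ->.
pose G i := detseq (set_nth 0 (T ++ [:: a; c]) i b) *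
  ((T ++ [:: a; c])`_i *m w) 0 0.
rewrite mulmx_suml summxE.
transitivity (\sum_(i < k) G i).
  by apply: eq_bigr => i _; rewrite -scalemxAl mxE.
have sumE (H : nat -> F) :
    \sum_(i < k) H i = \sum_(i < size T) H i + H (size T) + H (size T).+1.
  rewrite -(big_mkord xpredT); move: (size T) kE => t kE.
  by rewrite -kE !big_nat_recr//= big_mkord.
(* At an index inside [T] the second factor repeats a vector of [T]; only the terms of [a] and [c]
   survive. *)
rewrite sumE big1 ?add0r => [|i _]; last first.
  rewrite /G nth_cat ltn_ord -wE.
  suff -> : detseq (T ++ [:: T`_i; d]) = 0 by rewrite mulr0.
  rewrite -{1}(cat_take_drop i T) (drop_nth 0)// -catA cat_cons.
  by apply: detseq_dup; rewrite size_take size_drop ltn_ord; have := ltn_ord i; lia.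
have setE (u v z : 'rV[F]_k) : set_nth 0 (T ++ [:: u; v]) (size T) z = T ++ [:: z; v].
  by elim: (T) => //= t T' ->.
have setE' (u v z : 'rV[F]_k) :
    set_nth 0 (T ++ [:: u; v]) (size T).+1 z = T ++ [:: u; z].
  by elim: (T) => //= t T' ->.
rewrite /G setE setE' !nth_cat ltnn ltnNge leqnSn /= subnn subSnn /= -!wE.
by rewrite addrC [X in _ + X]mulrC.
Qed.

Lemma detseq_move2 A B C x y : (size A + size B + size C).+2 = k ->
  detseq (A ++ x :: B ++ y :: C) =
  (-1) ^+ (size B + size C) * (-1) ^+ size C *
    detseq (A ++ B ++ C ++ [:: x; y]).
Proof.
move=> kE; have -> : A ++ x :: B ++ y :: C = (A ++ x :: B) ++ y :: C ++ [::].
  by rewrite cats0 -catA.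
rewrite detseq_move ?size_cat /=; last by lia.
have -> : (A ++ x :: B) ++ C ++ [:: y] = A ++ x :: (B ++ C) ++ [:: y].
  by rewrite -!catA.
rewrite detseq_move ?size_cat; last by lia.
by rewrite -!catA mulrA [X in X * _]mulrC.
Qed.

(** Moving [p], [q], [r] or [s] to the end costs a sign that depends only on the blocks behind it.
    Each of the three products contains each of the four vectors once, so all carry the same sign
    and [pluecker_tail] applies. *)
Lemma pluecker A B C D E (p q r s : 'rV[F]_k) :
  (size A + size B + size C + size D + size E).+2 = k ->
  detseq (A ++ p :: B ++ C ++ r :: D ++ E) *
    detseq (A ++ B ++ q :: C ++ D ++ s :: E) =
  detseq (A ++ p :: B ++ q :: C ++ D ++ E) *
    detseq (A ++ B ++ C ++ r :: D ++ s :: E) +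
  detseq (A ++ p :: B ++ C ++ D ++ s :: E) *
    detseq (A ++ B ++ q :: C ++ r :: D ++ E).
Proof.
move=> kE.
have := @detseq_move2 A (B ++ C) (D ++ E) p r.
have := @detseq_move2 (A ++ B) (C ++ D) E q s.
have := @detseq_move2 A B (C ++ D ++ E) p q.
have := @detseq_move2 (A ++ B ++ C) D E r s.
have := @detseq_move2 A (B ++ C ++ D) E p s.
have := @detseq_move2 (A ++ B) C (D ++ E) q r.
rewrite -!catA /= -?catA !size_cat.
do 6 (move=> ->; last by lia).
have := @pluecker_tail (A ++ B ++ C ++ D ++ E) p q r s.
rewrite !size_cat -!catA => H; rewrite !exprD.
set x := detseq _; set y := detseq _; set z := detseq _; set t := detseq _.
set u := detseq _; set v := detseq _.
have {}H : x * y = z * t + u * v by apply: H; lia.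
rewrite -[LHS]/(_ * x * (_ * y)) mulrACA H; ring.
Qed.

End DetSeq.

(** * Subtraction-free functions on the positive orthant *)

Section SubtractionFree.
Variables (R : realType) (I : finType).
Local Notation Y := (I -> rpt R).
Implicit Types (f g : Y -> R) (y : Y).

Definition SF f := exists e : sfexpr I, forall y, f y = rpval (seval y e).

(** Entries of vectors may change sign. These differences form a ring, closed under division by [SF]
    functions, in which determinants live before their positivity is known. *)
Definition DF f := exists a b, [/\ SF a, SF b & forall y, f y = a y - b y].

Lemma SF_ext f g : f =1 g -> SF f -> SF g.
Proof. by move=> E [e eE]; exists e => y; rewrite -E. Qed.

Lemma SF_gt0 f y : SF f -> 0 < f y.
Proof. by case=> e ->; exact: rpval_gt0. Qed.

Lemma SF_neq0 f y : SF f -> f y != 0.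
Proof. by move=> /(SF_gt0 y) /lt0r_neq0. Qed.

Lemma SF_var i : SF (fun y => rpval (y i)).
Proof. by exists (SVar i). Qed.

Lemma SF1 : SF (fun=> 1).
Proof. by exists SOne. Qed.

Lemma SFD f g : SF f -> SF g -> SF (fun y => f y + g y).
Proof. by case=> a aE [b bE]; exists (SAdd a b) => y; rewrite aE bE. Qed.

Lemma SFM f g : SF f -> SF g -> SF (fun y => f y * g y).
Proof. by case=> a aE [b bE]; exists (SMul a b) => y; rewrite aE bE. Qed.

Lemma SF_div f g : SF f -> SF g -> SF (fun y => f y / g y).
Proof. by case=> a aE [b bE]; exists (SDiv a b) => y; rewrite aE bE. Qed.

Lemma DF_ext f g : f =1 g -> DF f -> DF g.
Proof. by move=> E [a [b [aS bS F]]]; exists a, b; split=> // y; rewrite -E. Qed.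

Lemma DF0 : DF (fun=> 0).
Proof. by exists (fun=> 1), (fun=> 1); split=> *; [exact: SF1..|rewrite subrr]. Qed.

Lemma DF_SF f : SF f -> DF f.
Proof.
move=> h; exists (fun y => f y + 1), (fun=> 1).
by split=> [||y]; [apply: SFD => //; exact: SF1|exact: SF1|rewrite addrK].
Qed.

Lemma DFN f : DF f -> DF (fun y => - f y).
Proof.
by case=> a [b [aS bS E]]; exists b, a; split=> // y; rewrite E opprB.
Qed.

Lemma DFD f g : DF f -> DF g -> DF (fun y => f y + g y).
Proof.
case=> a [b [aS bS E]] [c [d [cS dS G]]].
exists (fun y => a y + c y), (fun y => b y + d y).
by split=> [||y]; [exact: SFD..|rewrite E G; ring].
Qed.

Lemma DFM f g : DF f -> DF g -> DF (fun y => f y * g y).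
Proof.
case=> a [b [aS bS E]] [c [d [cS dS G]]].
exists (fun y => a y * c y + b y * d y), (fun y => a y * d y + b y * c y).
by split=> [||y]; [apply: SFD; exact: SFM..|rewrite E G; ring].
Qed.

Lemma DF_div f g : DF f -> SF g -> DF (fun y => f y / g y).
Proof.
case=> a [b [aS bS E]] gS; exists (fun y => a y / g y), (fun y => b y / g y).
by split=> [||y]; [exact: SF_div..|rewrite E mulrBl].
Qed.

Lemma DF_sign d : DF (fun=> (-1) ^+ d).
Proof.
elim: d => [|d IH]; first exact/DF_SF/SF1.
by apply: DF_ext (DFN IH) => y; rewrite exprS mulN1r.
Qed.

Lemma DF_sum (J : Type) (s : seq J) (h : J -> Y -> R) :
  (forall j, DF (h j)) -> DF (fun y => \sum_(j <- s) h j y).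
Proof.
move=> hD; elim: s => [|j s IH].
  by apply: DF_ext DF0 => y; rewrite big_nil.
by apply: DF_ext (DFD (hD j) IH) => y; rewrite big_cons.
Qed.

Lemma DF_prod (J : Type) (s : seq J) (h : J -> Y -> R) :
  (forall j, DF (h j)) -> DF (fun y => \prod_(j <- s) h j y).
Proof.
move=> hD; elim: s => [|j s IH].
  by apply: DF_ext (DF_SF SF1) => y; rewrite big_nil.
by apply: DF_ext (DFM (hD j) IH) => y; rewrite big_cons.
Qed.

(* With [b = u - w], the value [a / (2 u)] works for one constraint, and the
   harmonic combination of two values of epsilon satisfies both constraints. *)
Lemma SF_epsilon (T : eqType) (s : seq T) (a b : T -> Y -> R) :
  (forall i, DF (b i)) ->
  exists2 eps, SF eps & forall i, i \in s -> SF (a i) ->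
    SF (fun y => a i y - eps y * b i y).
Proof.
move=> bD; elim: s => [|i s [e eS IH]]; first by exists (fun=> 1); [exact: SF1|].
have [aS|naS] := pselect (SF (a i)); last first.
  exists e => // j; rewrite inE => /orP[/eqP->//|js]; exact: IH.
have [u [w [uS wS bE]]] := bD i.
have SF2 : SF (fun=> 1 + 1) by apply: SFD; exact: SF1.
pose e1 y := a i y / (u y * (1 + 1)).
have e1S : SF e1 by apply: SF_div => //; exact: SFM.
(* The new epsilon is [e * c1 = e1 * c] with [c + c1 = 1]. Each constraint becomes a convex
   combination of its value at epsilon 0 and its value at [e] or [e1]. *)
pose c y := e y / (e y + e1 y); pose c1 y := e1 y / (e y + e1 y).
have cS : SF c by apply: SF_div => //; exact: SFD.
have c1S : SF c1 by apply: SF_div => //; exact: SFD.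
have ne y : e y + e1 y != 0 by apply: SF_neq0 (SFD eS e1S).
exists (fun y => e y * c1 y) => [|j]; first exact: SFM.
rewrite inE => /orP[/eqP->|js] jS; last first.
  apply: SF_ext (SFD (SFM cS jS) (SFM c1S (IH j js jS))) => y.
  by rewrite /c /c1; field; exact: ne.
apply: SF_ext (SFD (SFM c1S aS) (SFM cS
  (SFD (SF_div aS SF2) (SFM e1S wS)))) => y.
rewrite /c /c1 bE; have u0 := SF_neq0 y uS; have := ne y.
have -> : a i y = e1 y * (u y * (1 + 1)).
  by rewrite /e1 divfK// mulf_neq0// gt_eqF// addr_gt0.
by move=> ne'; field.
Qed.

End SubtractionFree.

(** * Lists of vectors with subtraction-free maximal minors *)

Section PositiveConfigurations.
Variables (R : realType) (I : finType) (k : nat).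
Local Notation Y := (I -> rpt R).
Local Notation vfun := (Y -> 'rV[R]_k).
Implicit Types (y : Y) (w x : vfun) (L A M Z : seq vfun) (b : bitseq).

Definition at_ L y : seq 'rV[R]_k := [seq w y | w <- L].

Definition DFv w := forall j, DF (fun y => w y 0 j).
Definition DFs L := forall i, DFv (nth (fun=> 0) L i).

(** Masks keep the order of [L] and split along concatenations, so minors can be treated block by
    block. *)
Definition Pos L := forall b, size b = size L -> count id b = k ->
  SF (fun y => detseq (mask b (at_ L y))).

Lemma at_cat A M y : at_ (A ++ M) y = at_ A y ++ at_ M y.
Proof. exact: map_cat. Qed.

Lemma at_rcons A w y : at_ (rcons A w) y = rcons (at_ A y) (w y).
Proof. exact: map_rcons. Qed.

Lemma size_at L y : size (at_ L y) = size L.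
Proof. exact: size_map. Qed.

Lemma DFv0 : DFv (fun=> 0).
Proof. by move=> j; apply: DF_ext (DF0 R I) => y; rewrite mxE. Qed.

Lemma DFvD w x : DFv w -> DFv x -> DFv (fun y => w y + x y).
Proof.
by move=> wD xD j; apply: DF_ext (DFD (wD j) (xD j)) => y; rewrite mxE.
Qed.

Lemma DFvZ (c : Y -> R) w : DF c -> DFv w -> DFv (fun y => c y *: w y).
Proof. by move=> cD wD j; apply: DF_ext (DFM cD (wD j)) => y; rewrite mxE. Qed.

Lemma DFs_cat A M : DFs (A ++ M) <-> DFs A /\ DFs M.
Proof.
split=> [H|[HA HM] i]; last by rewrite nth_cat; case: ifP.
split=> i; have [lt|le] := ltnP i (size A).
- by have := H i; rewrite nth_cat lt.
- by rewrite nth_default//; exact: DFv0.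
- by have := H (size A + i)%N; rewrite nth_cat ltnNge leq_addr addKn.
- by have := H (size A + i)%N; rewrite nth_cat ltnNge leq_addr addKn.
Qed.

Lemma DFs_cons w L : DFs (w :: L) <-> DFv w /\ DFs L.
Proof.
split=> [H|[wD LD] [|i]//]; last exact: (LD i).
by split=> [|i]; [exact: (H 0%N)|exact: (H i.+1)].
Qed.

Lemma DFs_mask b L : DFs L -> DFs (mask b L).
Proof.
elim: b L => [|t b IH] [|w L] //=; try by move=> *; case=> [|i]; exact: DFv0.
by move=> /DFs_cons[wD LD]; case: t => /=; [apply/DFs_cons; split=> //|]; exact: IH.
Qed.

Lemma DF_det L : DFs L -> DF (fun y => detseq (at_ L y)).
Proof.
move=> LD; apply: DF_sum => s; apply: DFM; first exact: DF_sign.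
apply: DF_prod => i; apply: DF_ext (LD i (s i)) => y; rewrite mxE.
have [lt|le] := ltnP i (size L); first by rewrite (nth_map (fun=> 0)).
by rewrite !nth_default ?size_at// mxE.
Qed.

Lemma at_mask b L y : at_ (mask b L) y = mask b (at_ L y).
Proof. exact: map_mask. Qed.

Lemma mask_count_size b (T : Type) (s : seq T) :
  size b = size s -> count id b = size s -> mask b s = s.
Proof.
elim: b s => [|t b IH] [|x s] //= [sb]; case: t => /= cb.
  by rewrite IH//; move: cb; rewrite add1n => -[].
by have := count_size id b; rewrite -sb in cb *; lia.
Qed.

Lemma mask_count0 b (T : Type) (s : seq T) : count id b = 0%N -> mask b s = [::].
Proof.
by elim: b s => [|[] b IH] [|x s] //= /IH.
Qed.

Lemma Pos_sub A M Z : Pos (A ++ M ++ Z) -> (size A + size Z)%N = k ->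
  SF (fun y => detseq (at_ A y ++ at_ Z y)).
Proof.
move=> P sE.
pose b := nseq (size A) true ++ nseq (size M) false ++ nseq (size Z) true.
have := P b; rewrite !size_cat !size_nseq !count_cat !count_nseq /= mul0n !mul1n.
move=> /(_ erefl) /(_ sE); apply: SF_ext => y.
by rewrite /b !at_cat !mask_cat ?size_nseq ?size_at// !mask_true ?mask_false ?size_at.
Qed.

(* [W = x - eps W'], where [x] is the last vector of [A] and [W'] is obtained
   for [A] without [x]. A determinant containing [x] only sees [W']; in the
   others the term of [x] dominates. *)
Lemma append_aux c A Z : DFs (A ++ Z) -> Pos (A ++ Z) ->
  (size Z + c).+1 = k -> (c < size A)%N ->
  exists2 w, DFv w & forall b, size b = size A -> count id b = c ->
    SF (fun y => detseq (mask b (at_ A y) ++ w y :: at_ Z y)).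
Proof.
elim: c A Z => [|c IH] A Z D P kE; case/lastP: A D P => [//|A x] D P;
  rewrite size_rcons => lt.
  (* For [c = 0] only the minor on [x :: Z] is concerned, so [w = x] works. *)
  exists x => [|b sb c0].
    by have := D (size A); rewrite nth_cat size_rcons ltnSn nth_rcons ltnn eqxx.
  have := @Pos_sub [::] A (x :: Z); rewrite -cat_rcons addn0 in kE * => H.
  by apply: SF_ext (H P kE) => y; rewrite mask_count0.
have [] := IH A (x :: Z); rewrite -?cat_rcons//=; first by rewrite addSnnS.
move=> w' w'D H.
have /DFs_cat[AxD ZD] := D.
have [AD xD] : DFs A /\ DFv x.
  by move: AxD; rewrite -cats1 => /DFs_cat[? /DFs_cons[]].
(* The constraints on epsilon come from selections omitting the last vector [x] of the list:
   replacing [w] by [x - e w'] turns them into [Ab - e * Bb]. *)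
pose Ab (b : (size A).-tuple bool) y := detseq (mask b (at_ A y) ++ x y :: at_ Z y).
pose Bb (b : (size A).-tuple bool) y := detseq (mask b (at_ A y) ++ w' y :: at_ Z y).
have [] := @SF_epsilon R I _ (enum {: (size A).-tuple bool}) Ab Bb.
  move=> b; have : DFs (mask b A ++ w' :: Z).
    by apply/DFs_cat; split; [exact: DFs_mask|exact/DFs_cons].
  by move=> /DF_det; apply: DF_ext => y; rewrite at_cat at_mask.
move=> e eS E; exists (fun y => x y + (- e y) *: w' y).
  by apply: DFvD => //; apply: DFvZ => //; exact/DFN/DF_SF.
move=> b; case/lastP: b => // b t; rewrite !size_rcons => -[sb].
rewrite -(cats1 b t) count_cat /= addn0 => cb.
have mE y : mask (b ++ [:: t]) (at_ (rcons A x) y) =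
    mask b (at_ A y) ++ (if t then [:: x y] else [::]).
  by rewrite at_rcons -cats1 mask_cat ?size_at//; case: (t).
have szm y (c' : nat) : count id b = c' -> size (mask b (at_ A y)) = c'.
  by move=> <-; rewrite size_mask ?size_at.
case: t cb mE => cb mE.
  (* Here [x] is selected too: its copy in [w] contributes 0, and swapping [x] with [w'] absorbs the
     minus sign. *)
  have {}cb : count id b = c by move: cb; rewrite addn1 => -[].
  apply: SF_ext (SFM eS (H b sb cb)) => y; rewrite mE -catA /=.
  have lt' : ((size (mask b (at_ A y))).+1 < k)%N by rewrite (szm y c)//; lia.
  rewrite -[in RHS]cat_rcons detseqD ?size_rcons// detseqZ ?size_rcons//.
  rewrite !cat_rcons (@detseq_swap _ _ _ _ _ (w' y))// mulrNN.
  have := @detseq_dup _ _ (mask b (at_ A y)) [::] (at_ Z y) (x y).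
  by rewrite addn0 => ->//; rewrite add0r.
have {}cb : count id b = c.+1 by rewrite -cb addn0.
have sbt : size b == size A by apply/eqP.
have := E (Tuple sbt); rewrite mem_enum => /(_ isT) EE.
apply: SF_ext (EE _) => [y|].
  rewrite mE cats0 /Ab /Bb /= detseqD ?detseqZ ?(szm y c.+1)//; try lia.
  by rewrite mulNr.
have := P (b ++ true :: nseq (size Z) true).
rewrite !size_cat size_rcons count_cat /= size_nseq count_nseq sb cb addSnnS.
have kE' : (c.+1 + (1 + size Z))%N = k by lia.
rewrite mul1n => /(_ erefl kE'); apply: SF_ext => y.
by rewrite cat_rcons at_cat mask_cat ?size_at//= mask_true ?size_at.
Qed.

End PositiveConfigurations.

(** * Completing vectors to flags *)

Section Completion.
Variables (R : realType) (I : finType) (k : nat).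
Local Notation Y := (I -> rpt R).
Local Notation vfun := (Y -> 'rV[R]_k).
Implicit Types (y : Y) (w x : vfun) (L A B M Z : seq vfun) (b : bitseq).

Definition scalev (c : R) w : vfun := fun y => c *: w y.

Lemma detseq_scale (F : fieldType) (c : F) (s : seq 'rV[F]_k) :
  detseq [seq c *: v | v <- s] = c ^+ k * detseq s.
Proof.
rewrite /detseq -detZ; congr (\det _); apply/matrixP => i j; rewrite !mxE.
have [lt|le] := ltnP i (size s); first by rewrite (nth_map 0)// mxE.
by rewrite !nth_default ?size_map// !mxE mulr0.
Qed.

Lemma at_scale c L y : at_ (map (scalev c) L) y = [seq c *: v | v <- at_ L y].
Proof. by rewrite /at_ -!map_comp. Qed.

Lemma DFs_scale d L : DFs L -> DFs (map (scalev ((-1) ^+ d)) L).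
Proof.
elim: L => [//|w L IH] /DFs_cons[wD LD]; apply/DFs_cons; split; last exact: IH.
by apply: DFvZ => //; exact: DF_sign.
Qed.

Lemma Pos_scale c L : c ^+ k = 1 -> Pos L -> Pos (map (scalev c) L).
Proof.
move=> c1 P b; rewrite size_map => sb cb.
apply: SF_ext (P b sb cb) => y.
by rewrite at_scale -(map_mask ( *:%R c)) detseq_scale c1 mul1r.
Qed.

Lemma Pos_rcons L x : Pos L ->
  (forall b, size b = size L -> (count id b).+1 = k ->
     SF (fun y => detseq (mask b (at_ L y) ++ [:: x y]))) ->
  Pos (rcons L x).
Proof.
move=> P Q b; case/lastP: b => [|b t]; rewrite !size_rcons => // -[sb].
rewrite -cats1 count_cat /= addn0; case: t => cb.
  rewrite addn1 in cb; apply: SF_ext (Q b sb cb) => y.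
  by rewrite at_rcons -cats1 mask_cat ?size_at.
rewrite addn0 in cb; apply: SF_ext (P b sb cb) => y.
by rewrite at_rcons -[in RHS]cats1 mask_cat ?size_at ?cats0.
Qed.

(** The vector from [append_aux] is divided by its minor [rho] with the last [k - 1] vectors of [L].
    As [rho] is subtraction-free, positivity survives and that minor becomes 1. *)
Lemma append_vector L : (0 < k <= size L)%N -> Pos L -> DFs L ->
  exists x, [/\ DFv x, Pos (rcons L x) &
    forall y, detseq (drop (size L - k.-1) (at_ L y) ++ [:: x y]) = 1].
Proof.
move=> /andP[k0 kL] P D.
have [||||w wD H] := @append_aux R I k k.-1 L [::]; rewrite ?cats0 ?add0n ?prednK//.
have H0 (c : Y -> R) y b : size b = size L -> (count id b).+1 = k ->
    detseq (mask b (at_ L y) ++ [:: c y *: w y]) =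
    c y * detseq (mask b (at_ L y) ++ [:: w y]).
  by move=> sb cb; rewrite detseqZ// size_mask ?size_at//; lia.
pose b0 := nseq (size L - k.-1) false ++ nseq k.-1 true.
have sb0 : size b0 = size L by rewrite size_cat !size_nseq subnK//; lia.
have cb0 : count id b0 = k.-1 by rewrite count_cat !count_nseq mul0n mul1n.
have b0E y : mask b0 (at_ L y) = drop (size L - k.-1) (at_ L y).
  rewrite -{1}[at_ L y](cat_take_drop (size L - k.-1)) mask_cat.
    by rewrite mask_false mask_true// size_drop size_at; lia.
  by rewrite size_nseq size_take size_at; case: ltnP => //; lia.
pose rho y := detseq (mask b0 (at_ L y) ++ [:: w y]).
have rS : SF rho by apply: H.
have riS : SF (fun y => 1 / rho y) by apply: SF_div => //; exact: SF1.
exists (fun y => (1 / rho y) *: w y); split.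
- by apply: DFvZ => //; exact: DF_SF.
- apply: Pos_rcons => // b sb cb.
  have cb' : count id b = k.-1 by lia.
  apply: SF_ext (SFM riS (H b sb cb')) => y.
  by rewrite (H0 (fun y => 1 / rho y)).
- move=> y; rewrite -b0E (H0 (fun y => 1 / rho y)) ?cb0 ?prednK//.
  by rewrite div1r mulVf//; exact: SF_neq0.
Qed.

(** The sign of a cyclic shift of [k] vectors. Since [k * (k - 1)] is even, its [k]-th power is 1,
    and scaling all vectors by it changes no maximal minor. *)
Definition rot_sign : R := (-1) ^+ k.-1.

Lemma rot_sign_exp : rot_sign ^+ k = 1.
Proof.
rewrite /rot_sign -exprM -signr_odd oddM.
by case: k => //= d; case: odd; rewrite //= expr0.
Qed.

(** A vector moved from the end to the front passes the [k - 1] others in each minor containing it;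
    the scaling cancels that sign. The vectors of [B] move one at a time, the last one first. *)
Lemma Pos_rotate A B : Pos (A ++ B) -> Pos (map (scalev rot_sign) B ++ A).
Proof.
elim/last_ind: B A => [|B w IH] A; first by rewrite cats0.
rewrite -rcons_cat => P.
have {P} : Pos ((scalev rot_sign w :: A) ++ B).
  move=> [//|t b] /= [sb] cb.
  have := P (rcons b t); rewrite !size_rcons sb -cats1 count_cat /= addn0 addnC.
  move=> /(_ erefl cb); apply: SF_ext => y.
  rewrite at_rcons -[X in mask _ X]cats1 mask_cat ?size_at//.
  case: t cb => /= cb; last by rewrite cats0.
  have sm : size (mask b (at_ (A ++ B) y)) = k.-1.
    by rewrite size_mask ?size_at ?sb//; lia.
  have := @detseq_move R k [::] (mask b (at_ (A ++ B) y)) [::] (w y).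
  rewrite !cats0 /= => E; have lt : (0 + size (mask b (at_ (A ++ B) y)) < k)%N.
    by rewrite sm; lia.
  have Z := @detseqZ R k [::] (mask b (at_ (A ++ B) y)) rot_sign (w y).
  by rewrite /scalev Z ?E//=; last lia; rewrite sm mulrA /rot_sign -expr2 sqrr_sign mul1r.
move=> /IH; rewrite map_rcons -cats1 -catA; exact.
Qed.

Lemma drop_catl (T : Type) j (s t : seq T) : (j <= size s)%N ->
  drop j (s ++ t) = drop j s ++ t.
Proof.
rewrite drop_cat leq_eqVlt => /orP[/eqP->|->//].
by rewrite ltnn subnn drop0 drop_size.
Qed.

Lemma append_vectors c L : (0 < k <= size L)%N -> Pos L -> DFs L ->
  exists W, [/\ size W = c.+1, Pos (L ++ W), DFs (L ++ W) &
    forall y, detseq (drop (size L + c.+1 - k) (at_ (L ++ W) y)) = 1].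
Proof.
move=> /[dup] kL' /andP[k0 kL] P D; elim: c => [|c [W [sW WP WD _]]].
  have [x [xD xP E]] := append_vector kL' P D.
  exists [:: x]; split=> [//|||y]; first by rewrite cats1.
    by apply/DFs_cat; split=> //; apply/DFs_cons; split=> // i; rewrite nth_nil; exact: DFv0.
  rewrite at_cat drop_catl ?size_at; last by lia.
  by rewrite (_ : size L + 1 - k = size L - k.-1)%N; [exact: E|lia].
have [|x [xD xP E]] := @append_vector (L ++ W) _ WP WD.
  by rewrite k0 size_cat sW; lia.
exists (rcons W x); rewrite size_rcons sW -rcons_cat; split=> // [|y].
  rewrite -cats1; apply/DFs_cat; split=> //; apply/DFs_cons; split=> // i.
  by rewrite nth_nil; exact: DFv0.
rewrite at_rcons -cats1 drop_catl ?size_at ?size_cat ?sW; last by lia.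
rewrite (_ : size L + c.+2 - k = size (L ++ W) - k.-1)%N; first exact: E.
by rewrite size_cat sW; lia.
Qed.

(* Append [k - 1] vectors after the last vector of [r] and rotate the completed
   block to the front. *)
Lemma complete_blocks r A : (1 < k <= size A + size r)%N ->
  Pos (A ++ r) -> DFs (A ++ r) ->
  exists Bs : seq (seq vfun), [/\ size Bs = size r, Pos (flatten Bs ++ A) &
    forall i, (i < size r)%N ->
      [/\ size (nth [::] Bs i) = k,
          forall y, detseq (at_ (nth [::] Bs i) y) = 1 &
          forall y, head 0 (at_ (nth [::] Bs i) y) =
            rot_sign *: nth (fun=> 0) r i y]].
Proof.
elim/last_ind: r A => [|r x IH] A /andP[k1 kA] P D.
  by exists [::]; split=> //=; rewrite cats0 in P.
have k0 : (0 < k)%N by lia.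
(* [W] has [k - 1] vectors, so the last [k] vectors of the list are exactly [x :: W], and their
   determinant is normalized to 1. *)
have [|W [sW WP WD E]] := @append_vectors k.-2 _ _ P D.
  by rewrite k0 size_cat.
set B := map (scalev rot_sign) (x :: W).
have EW : (A ++ rcons r x) ++ W = (A ++ r) ++ x :: W by rewrite -cats1 -!catA.
rewrite EW in WP WD E.
have sxW : size (x :: W) = k by rewrite /= sW; lia.
have sB : size B = k by rewrite size_map sxW.
have [|||Bs [sBs BsP BsE]] := IH (B ++ A).
- by rewrite k1 size_cat sB; lia.
- by have := Pos_rotate WP; rewrite catA.
- rewrite -catA; case/DFs_cat: WD => WD xWD.
  by apply/DFs_cat; split=> //; exact: DFs_scale.
exists (rcons Bs B); rewrite !size_rcons sBs; split=> //.
  by rewrite flatten_rcons -catA.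
move=> i; rewrite ltnS leq_eqVlt !nth_rcons sBs => /orP[/eqP->|lt].
  rewrite ltnn eqxx; split=> [//|y|y].
  rewrite at_scale detseq_scale rot_sign_exp mul1r.
  have := E y; rewrite at_cat drop_cat size_at !size_cat size_rcons.
  rewrite (_ : _ + _ - k = size A + size r)%N; last by lia.
  by rewrite ltnn subnn drop0.
  by [].
by rewrite lt; exact: BsE.
Qed.

Lemma flag_blocks L : (1 < k <= size L)%N -> Pos L -> DFs L ->
  exists Bs : seq (seq vfun), [/\ size Bs = size L, Pos (flatten Bs) &
    forall i, (i < size L)%N ->
      [/\ size (nth [::] Bs i) = k,
          forall y, detseq (at_ (nth [::] Bs i) y) = 1 &
          forall y, head 0 (at_ (nth [::] Bs i) y) = nth (fun=> 0) L i y]].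
Proof.
move=> kL P D; have [//|//|//|Bs [sBs BsP BsE]] := @complete_blocks L [::].
(* Each block was scaled by [rot_sign] once, when it was rotated; a second scaling restores its
   first vector. *)
exists (map (map (scalev rot_sign)) Bs); rewrite size_map; split=> //.
  by rewrite -map_flatten; apply: Pos_scale rot_sign_exp _; rewrite cats0 in BsP.
move=> i lt; rewrite (nth_map [::]) ?sBs//; have [sB dB hB] := BsE i lt.
split=> [|y|y]; first by rewrite size_map.
  by rewrite at_scale detseq_scale rot_sign_exp mul1r.
have := hB y; case: (nth _ _ _) sB => [/= k0|w B _ /= hw].
  by exfalso; lia.
rewrite /scalev hw scalerA /rot_sign -expr2 sqrr_sign; exact: scale1r.
Qed.

End Completion.

(** * Vectors with prescribed Pluecker coordinates *)

Section PrescribedMinors.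
Variables (R : realType) (I : finType) (k : nat).
Local Notation Y := (I -> rpt R).
Local Notation vfun := (Y -> 'rV[R]_k).
Implicit Types (y : Y) (w x : vfun) (L A B M Z : seq vfun) (b : bitseq).

Lemma Pos_mid A M Z b : Pos (A ++ M ++ Z) -> size b = size M ->
  (size A + count id b + size Z)%N = k ->
  SF (fun y => detseq (at_ A y ++ mask b (at_ M y) ++ at_ Z y)).
Proof.
move=> P sb cb; have := P (nseq (size A) true ++ b ++ nseq (size Z) true).
rewrite !size_cat !size_nseq !count_cat !count_nseq /= !mul1n sb [X in X = k -> _]addnA => /(_ erefl cb).
apply: SF_ext => y; rewrite !at_cat !mask_cat ?size_nseq ?size_at//.
by rewrite !mask_true ?size_at.
Qed.

(* If a determinant containing [x] is not of the form "prefix and suffix of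
   [L]", then it contains some [j] lying between omitted vectors [i] and [l], and
   a three-term relation exchanges [j] for [i] or for [l]. *)
Lemma Pos_extend L x : Pos L ->
  (forall A M Z, L = A ++ M ++ Z -> (size A + size Z).+1 = k ->
     SF (fun y => detseq (at_ A y ++ at_ Z y ++ [:: x y]))) ->
  Pos (rcons L x).
Proof.
move=> P H; apply: Pos_rcons => // b sb cb.
(* Induction on the number [c] of vectors selected strictly between a full prefix [A] and a full
   suffix [Z]; [H] is the case [c = 0]. *)
suff Q c A M Z b' : L = A ++ M ++ Z -> size b' = size M -> count id b' = c ->
    (size A + c + size Z).+1 = k ->
    SF (fun y => detseq (at_ A y ++ mask b' (at_ M y) ++ at_ Z y ++ [:: x y])).
  have := Q (count id b) [::] L [::] b; rewrite cats0 add0n addn0.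
  by move=> /(_ erefl sb erefl cb).
elim: c A M Z b' {b sb cb} => [|c IH] A M Z b LE sb cb kE.
  rewrite addn0 in kE; apply: SF_ext (H A M Z LE kE) => y.
  by rewrite mask_count0.
case: b M LE sb cb => [|t b] [|i M] //= LE [sb]; case: t => /= cb.
  have {}cb : count id b = c by lia.
  have LE' : L = rcons A i ++ M ++ Z by rewrite cat_rcons.
  have := IH _ _ _ b LE' sb cb; rewrite size_rcons addSnnS => /(_ kE).
  by apply: SF_ext => y; rewrite at_rcons cat_rcons.
case/lastP: b M LE sb cb => [|b t]; case/lastP => [|M l] //;
  rewrite ?size_rcons// => LE [sb]; rewrite -cats1 count_cat /=.
case: t => /=; rewrite addn0 => cb.
  have {}cb : count id (false :: b) = c by rewrite /=; lia.
  have LE' : L = A ++ (i :: M) ++ l :: Z by rewrite LE -cats1 /= -catA.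
  have := IH _ _ _ (false :: b) LE'; rewrite /= sb => /(_ erefl cb).
  have kE' : (size A + c + (size Z).+1).+1 = k by lia.
  move=> /(_ kE'); apply: SF_ext => y.
  by rewrite at_rcons -cats1 mask_cat ?size_at//= -catA.
have tb : true \in b.
  have : has id b by rewrite has_count; lia.
  by case/hasP => -[].
case/splitPr: tb sb cb => b1 b2; rewrite size_cat count_cat /= => sM cb.
have ltM : (size b1 < size M)%N by rewrite -sM addnS ltnS leq_addr.
have := cat_take_drop (size b1) M; rewrite (drop_nth x)//.
set M1 := take _ M; set j := nth x M _; set M2 := drop _ M => ME.
have sM1 : size M1 = size b1 by rewrite size_take ltM.
have sM2 : size M2 = size b2 by rewrite size_drop -sM addnS subSS addKn.
rewrite -{}ME in LE sM ltM *.
pose m1 y := mask b1 (at_ M1 y); pose m2 y := mask b2 (at_ M2 y).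
(* Besides [m1] and [m2], the three bits select [i], [j] and [l]. *)
pose bb (t t1 t2 : bool) := t :: (b1 ++ t1 :: b2) ++ [:: t2].
have sbb (t t1 t2 : bool) : size (bb t t1 t2) = size (i :: rcons (M1 ++ j :: M2) l).
  by rewrite /= size_rcons !size_cat /= sM1 sM2 addn1.
have cbb (t t1 t2 : bool) : count id (bb t t1 t2) = (t + t1 + t2 + c)%N.
  by rewrite /= !count_cat /=; lia.
have mE (t t1 t2 : bool) y : mask (bb t t1 t2) (at_ (i :: rcons (M1 ++ j :: M2) l) y) =
    nseq t (i y) ++ m1 y ++ nseq t1 (j y) ++ m2 y ++ nseq t2 (l y).
  rewrite -cats1 /at_ map_cons mask_cons; congr (_ ++ _).
  rewrite -!catA !map_cat mask_cat ?size_map ?sM1//; congr (_ ++ _).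
  rewrite !mask_cat /= ?size_map ?sM2//.
  by case: t1; case: t2.
have PL (t t1 t2 : bool) : (t + t1 + t2 = 2)%N -> SF (fun y => detseq (at_ A y ++
    (nseq t (i y) ++ m1 y ++ nseq t1 (j y) ++ m2 y ++ nseq t2 (l y)) ++ at_ Z y)).
  move=> t2E; have := @Pos_mid A (i :: rcons (M1 ++ j :: M2) l) Z (bb t t1 t2).
  rewrite cbb sbb -LE => /(_ P erefl) F; have {}F := F ltac:(lia).
  by apply: SF_ext F => y; rewrite mE.
have P1 := PL true false true erefl.
have P2 := PL true true false erefl.
have P3 := PL false true true erefl.
have cb' : count id (bb false false false) = c by rewrite cbb.
(* Exchanging [j] for [l] enlarges the suffix, and exchanging it for [i] in [Q2] enlarges the
   prefix; either way one fewer vector is selected in the middle. *)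
have Q1 : SF (fun y => detseq (at_ A y ++ m1 y ++ m2 y ++ l y :: at_ Z y ++ [:: x y])).
  have LE' : L = A ++ (i :: M1 ++ j :: M2) ++ l :: Z.
    by rewrite LE -cats1 /= -!catA.
  have := IH _ _ _ (false :: b1 ++ false :: b2) LE'.
  rewrite /= !size_cat !count_cat /= sM1 sM2 => /(_ erefl) F.
  have {}F := F ltac:(lia) ltac:(lia); apply: SF_ext F => y.
  by rewrite at_cat mask_cat ?size_at ?sM1// -!catA.
have Q2 : SF (fun y => detseq (at_ A y ++ i y :: m1 y ++ m2 y ++ at_ Z y ++ [:: x y])).
  have LE' : L = rcons A i ++ rcons (M1 ++ j :: M2) l ++ Z by rewrite cat_rcons.
  have := IH _ _ _ ((b1 ++ false :: b2) ++ [:: false]) LE'.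
  rewrite !size_rcons !size_cat !count_cat /= sM1 sM2 addn1.
  move=> /(_ erefl) F; have {}F := F ltac:(lia) ltac:(lia); apply: SF_ext F => y.
  rewrite at_rcons cat_rcons; have := mE true false false y => /= -[->].
  by rewrite !cats0 -!catA.
apply: SF_ext (SF_div (SFD (SFM P2 Q1) (SFM Q2 P3)) P1) => y.
have := mE false true false y; rewrite /= cats0 cats1 => ->.
have sm1 : size (m1 y) = count id b1 by rewrite size_mask ?size_at.
have sm2 : size (m2 y) = count id b2 by rewrite size_mask ?size_at.
have := @pluecker R k (at_ A y) (m1 y) (m2 y) (at_ Z y) [::] (i y) (j y) (l y) (x y).
rewrite /= !cats0 sm1 sm2 size_at size_at => F; have {F} := F ltac:(lia).
move: (SF_neq0 y P1); rewrite /= ?cats0 -!catA /= -!catA => ne <-.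
by rewrite mulrAC mulfV// mul1r.
Qed.

(* The conditions on [x] are linear and triangular in the basis formed by the
   first [k] vectors of [L]. *)
Lemma next_vector L (z : nat -> Y -> R) : (0 < k <= size L)%N ->
  Pos L -> DFs L -> (forall a, SF (z a)) ->
  exists x, [/\ DFv x, Pos (rcons L x) & forall a y, (a < k)%N ->
    detseq (take a (at_ L y) ++ drop (size L - (k - a.+1)) (at_ L y) ++ [:: x y])
      = z a y].
Proof.
move=> /andP[k0 kL] P D zS.
pose s a y := take a (at_ L y) ++ drop (size L - (k - a.+1)) (at_ L y).
have ss a y : (a < k)%N -> size (s a y) = k.-1.
  move=> lt; rewrite size_cat size_drop size_at size_takel ?size_at; lia.
suff [x [xD xE]] : exists x, DFv x /\ forall a y, (a < k)%N ->
    detseq (s a y ++ [:: x y]) = z a y.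
  exists x; split=> // [|a y lt]; last by rewrite catA; exact: xE.
  apply: Pos_extend => // A M Z LE kE; have lt : (size A < k)%N by lia.
  apply: SF_ext (zS (size A)) => y; rewrite -xE// /s catA LE !at_cat.
  rewrite take_size_cat ?size_at// !size_cat catA drop_size_cat//.
  by rewrite size_cat !size_at; lia.
(* Conditions are met in order of decreasing [a]. Adding a multiple of the vector [u] at position
   [a0] leaves those with [a > a0] intact, because [u] already occurs in them. *)
suff Q d : (d <= k)%N -> exists x, DFv x /\ forall a y, (k - d <= a < k)%N ->
    detseq (s a y ++ [:: x y]) = z a y.
  have [x [xD xE]] := Q k (leqnn k); exists x; split=> // a y lt.
  by apply: xE; rewrite subnn.
elim: d => [_|d IH lt].
  by exists (fun=> 0); split=> [|a y]; [exact: DFv0|lia].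
have [x [xD xE]] := IH (ltnW lt); pose a0 := (k - d.+1)%N.
have a0k : (a0 < k)%N by rewrite /a0; lia.
pose u := nth (fun=> 0) L a0.
have uE y : u y = (at_ L y)`_a0 by rewrite (nth_map (fun=> 0))//; exact: leq_trans a0k kL.
pose b0 := (size L - (k - a0.+1))%N.
(* Up to sign, the coefficient of [u] in condition [a0]. It is a maximal minor of [L], hence a
   legitimate divisor. *)
pose psi y := detseq (take a0.+1 (at_ L y) ++ drop b0 (at_ L y)).
have psiS : SF psi.
  have LE : L = take a0.+1 L ++ drop a0.+1 (take b0 L) ++ drop b0 L.
    have -> : take a0.+1 L = take a0.+1 (take b0 L).
      by rewrite take_takel// /b0; lia.
    by rewrite catA !cat_take_drop.
  have := @Pos_sub R I k (take a0.+1 L) (drop a0.+1 (take b0 L)) (drop b0 L).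
  rewrite -LE size_takel ?size_drop; last by lia.
  move=> /(_ P) F; have {}F := F ltac:(rewrite /b0; lia).
  by apply: SF_ext F => y; rewrite /psi /at_ map_take map_drop.
have sgn y : detseq (s a0 y ++ [:: u y]) = (-1) ^+ (k - a0.+1) * psi y.
  have := @detseq_move R k (take a0 (at_ L y)) (drop b0 (at_ L y)) [::] (u y).
  rewrite !cats0 size_takel ?size_drop ?size_at; last by lia.
  rewrite (_ : size L - b0 = k - a0.+1)%N => [F|]; last by rewrite /b0; lia.
  rewrite /s -catA -/b0 /psi (take_nth 0) ?size_at; last by lia.
  by rewrite -uE cat_rcons F ?mulrA -?expr2 ?sqrr_sign ?mul1r//; lia.
pose f y := detseq (s a0 y ++ [:: x y]).
have fD : DF f.
  have := @DF_det R I k (take a0 L ++ drop b0 L ++ [:: x]).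
  have -> : (fun y => detseq (at_ (take a0 L ++ drop b0 L ++ [:: x]) y)) = f.
    by apply/funext => y; rewrite !at_cat /at_ map_take map_drop catA.
  apply; apply/DFs_cat; split; last (apply/DFs_cat; split).
  - by have := D; rewrite -{1}(cat_take_drop a0 L) => /DFs_cat[].
  - by have := D; rewrite -{1}(cat_take_drop b0 L) => /DFs_cat[].
  - by apply/DFs_cons; split=> // i; rewrite nth_nil; exact: DFv0.
pose c y := (-1) ^+ (k - a0.+1) * ((z a0 y - f y) / psi y).
have cD : DF c.
  apply: DFM; first exact: DF_sign.
  by apply: DF_div => //; apply: DFD; [exact: DF_SF|exact: DFN].
exists (fun y => x y + c y *: u y); split.
  by apply: DFvD => //; apply: DFvZ => //; exact: D.
move=> a y /andP[le ak].
have sk : (size (s a y) < k)%N by rewrite ss//; lia.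
rewrite detseqD// detseqZ//.
have [a0a|aa0] := ltnP a0 a; last first.
  have -> : a = a0 by rewrite /a0 in aa0 *; lia.
  rewrite sgn -/(f y) /c mulrACA -expr2 sqrr_sign mul1r divfK ?subrKC//.
  exact: SF_neq0.
rewrite xE; last by rewrite /a0 in a0a; lia.
suff -> : detseq (s a y ++ [:: u y]) = 0 by rewrite mulr0 addr0.
have tE : take a (at_ L y) = take a0 (at_ L y) ++ u y :: drop a0.+1 (take a (at_ L y)).
  have aL : (a <= size (at_ L y))%N by rewrite size_at; exact: leq_trans (ltnW ak) kL.
  rewrite uE -[in RHS](nth_take 0 a0a) -drop_nth ?size_takel//.
  by rewrite -[in LHS](cat_take_drop a0 (take a (at_ L y))) take_takel// ltnW.
have := sk; rewrite /s tE -!catA cat_cons catA !size_cat /= size_cat => sk'.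
rewrite -catA cat_cons catA; apply: detseq_dup.
by rewrite size_cat -addnS.
Qed.

(** Each vector after the first [k] is the last member of exactly [k] chart coordinates, one for
    each [a < k], as many as it has entries. The pairs with [a = k] or [a = i] all describe the
    initial interval, whose minor is prescribed by [z0]. *)
Lemma vectors_exist (N : nat) (z0 : Y -> R) (z : nat -> nat -> Y -> R) :
  (0 < k <= N)%N -> SF z0 -> (forall a i, SF (z a i)) ->
  exists L, [/\ size L = N, Pos L, DFs L,
    forall y, detseq (take k (at_ L y)) = z0 y &
    forall a i y, (a < k)%N -> (a < i)%N -> (i + (k - a) <= N)%N ->
      detseq (take a (at_ L y) ++ take (k - a) (drop i (at_ L y))) = z a i y].
Proof.
move=> /andP[k0 kN] z0S zS; rewrite -(subnKC kN).
elim: (N - k)%N => {N kN} [|d]; last set N := (k + d)%N.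
  rewrite addn0.
  (* The first [k] vectors are the standard basis with one vector scaled by [z0]. *)
  pose c i y := if i == 0%N then z0 y else 1.
  have cS i : SF (c i) by rewrite /c; case: eqP => _ //; exact: SF1.
  pose w i : vfun := fun y => c i y *: \row_(j < k) (i == j)%:R.
  pose L := map w (iota 0 k).
  have sL : size L = k by rewrite size_map size_iota.
  have LE y : detseq (at_ L y) = z0 y.
    rewrite /detseq; have -> : \matrix_(j < k) (at_ L y)`_j =
        diag_mx (\row_(j < k) c j y).
      apply/matrixP => i j; rewrite !mxE (nth_map (fun=> 0)) ?sL//.
      by rewrite (nth_map 0%N) ?size_iota// nth_iota// add0n !mxE -val_eqE mulr_natr.
    rewrite det_diag (bigD1 (Ordinal k0))//= mxE big1 ?mulr1// => i ne.
    rewrite mxE /c; case: eqP => // i0; case/eqP: ne; exact: val_inj.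
  exists L; split=> // [b sb cb|i j|y|a i y]; last by lia.
  - apply: SF_ext z0S => y; by rewrite mask_count_size ?LE// size_at ?sb// cb sL.
  - have [lt|le] := ltnP i (size L); last first.
      by rewrite nth_default//; exact: DFv0.
    rewrite (nth_map 0%N); last by rewrite size_map in lt.
    apply: DFvZ => [|j']; first exact/DF_SF.
    have := DF0 R I; have := DF_SF (SF1 R I); case: (boolP (nth 0%N (iota 0 k) i == j')) => h d1 d0.
      by apply: DF_ext d1 => y; rewrite mxE h.
    by apply: DF_ext d0 => y; rewrite mxE (negbTE h).
  - by rewrite take_oversize ?LE// size_at sL.
case=> L [sL P D E0 E]; rewrite addnS -/N.
have kN : (k <= N)%N by rewrite leq_addr.
(* An interval of length [k - a] ending at the new vector starts at [N.+1 - (k - a)]. *)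
have [||x [xD xP xE]] := @next_vector L (fun a => z a (N.+1 - (k - a))%N) _ P D.
- by rewrite k0 sL.
- by move=> a; exact: zS.
exists (rcons L x); rewrite size_rcons sL; split=> // [|y|a i y ak ai].
- by rewrite -cats1; apply/DFs_cat; split=> //; apply/DFs_cons; split=> // i;
    rewrite nth_nil; exact: DFv0.
- by rewrite at_rcons -cats1 takel_cat ?E0// size_at sL.
have aN : (a <= size (at_ L y))%N.
  by rewrite size_at sL; exact: leq_trans (ltnW ak) kN.
rewrite at_rcons -cats1 takel_cat// leq_eqVlt => /orP[/eqP iE|lt].
  rewrite drop_catl ?size_at ?sL; last by lia.
  rewrite [take (k - a) _]take_oversize; last by rewrite size_cat size_drop size_at sL /=; lia.
  have -> : i = (N.+1 - (k - a))%N by lia.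
  by rewrite -xE// sL (_ : N - (k - a.+1) = N.+1 - (k - a))%N//; lia.
rewrite drop_catl ?size_at ?sL; last by lia.
by rewrite takel_cat ?E// size_drop size_at sL; lia.
Qed.

End PrescribedMinors.

(** * Flag minors in the chart of a triangulation *)

Section FlagMinors.
Variables (F : fieldType) (k n : nat).
Implicit Types (m : 'I_n -> nat) (P : flags F k n) (w : seq 'I_n).

Lemma size_vecs (M : 'M[F]_k) : size (vecs M) = k.
Proof. by rewrite size_map size_enum_ord. Qed.

Lemma detseq_vecs (M : 'M[F]_k) : detseq (vecs M) = \det M.
Proof.
congr (\det _); apply/row_matrixP => i.
by rewrite rowK (nth_map i) ?size_enum_ord// nth_ord_enum.
Qed.

Lemma flag_minor_ext m m' P : m =1 m' -> flag_minor m P = flag_minor m' P.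
Proof. by move=> /funext->. Qed.

(** Natural-number indices allow [iota 0 n] to be cut at the vertices of an exchange relation. *)
Definition fblock m P (i : nat) : seq 'rV[F]_k :=
  if insub i is Some p then take (m p) (vecs (val (P p))) else [::].

Lemma fblockE m P (p : 'I_n) : fblock m P p = take (m p) (vecs (val (P p))).
Proof. by rewrite /fblock valK. Qed.

Lemma flag_minorE m P :
  flag_minor m P = detseq (flatten [seq fblock m P i | i <- iota 0 n]).
Proof.
rewrite /flag_minor -val_enum_ord -map_comp; congr (detseq (flatten _)).
by apply: eq_map => p; rewrite /= fblockE.
Qed.

Lemma iota_split a b i : (a <= i < a + b)%N ->
  iota a b = iota a (i - a) ++ i :: iota i.+1 (a + b - i.+1).
Proof.
move=> /andP[ai iab]; have -> : b = ((i - a) + (a + b - i.+1).+1)%N by lia.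
rewrite iotaD subnKC//=; congr (_ ++ _ :: iota _ _); lia.
Qed.

Lemma fblock_eq m m' P s : (forall p : 'I_n, (p : nat) \in s -> m p = m' p) ->
  flatten [seq fblock m P i | i <- s] = flatten [seq fblock m' P i | i <- s].
Proof.
move=> E; congr flatten; apply/eq_in_map => i iS; rewrite /fblock.
by case: insubP => // p _ pi; rewrite E ?pi.
Qed.

Lemma size_fblocks m P : (forall p, m p <= k)%N ->
  size (flatten [seq fblock m P i | i <- iota 0 n]) = (\sum_p m p)%N.
Proof.
move=> mk; rewrite -val_enum_ord -map_comp size_flatten /shape -map_comp.
rewrite sumnE big_map -[RHS]big_enum /=; apply: eq_bigr => p _ /=.
by rewrite fblockE size_takel ?size_vecs.
Qed.

Lemma flag_pluecker m P (p q r s : 'I_n) : (p < q)%N -> (q < r)%N -> (r < s)%N ->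
  (\sum_x m x).+2 = k ->
  let M (a b : 'I_n) := flag_minor (fun x => (a == x) + ((b == x) + m x))%N P in
  M p r * M q s = M p q * M r s + M p s * M q r.
Proof.
move=> pq qr rs mE M.
have mk x : (m x < k)%N by rewrite -mE (bigD1 x)//=; lia.
(* The bits tell which of [p], [q], [r], [s] contribute one vector more. It is appended to the block
   of its vertex, so the blocks have the shape required by [pluecker]. *)
pose mm (t1 t2 t3 t4 : bool) x :=
  (m x + (t1 * (x == p) + t2 * (x == q) + t3 * (x == r) + t4 * (x == s)))%N.
pose f s := flatten [seq fblock m P i | i <- s].
pose v (x : 'I_n) := (vecs (val (P x)))`_(m x).
pose A := f (iota 0 p) ++ fblock m P p.
pose B := f (iota p.+1 (q - p.+1)) ++ fblock m P q.
pose C := f (iota q.+1 (r - q.+1)) ++ fblock m P r.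
pose D := f (iota r.+1 (s - r.+1)) ++ fblock m P s.
pose E := f (iota s.+1 (n - s.+1)).
have sp : (s < n)%N := ltn_ord s.
have iE : iota 0 n = iota 0 p ++ (p : nat) :: iota p.+1 (q - p.+1) ++
    (q : nat) :: iota q.+1 (r - q.+1) ++ (r : nat) :: iota r.+1 (s - r.+1) ++
    (s : nat) :: iota s.+1 (n - s.+1).
  rewrite (@iota_split 0 n p) ?subn0 ?add0n; last by lia.
  rewrite (@iota_split p.+1 _ q); last by lia.
  rewrite (@iota_split q.+1 _ r); last by lia.
  rewrite (@iota_split r.+1 _ s); last by lia.
  by do 4 (congr (_ ++ _ :: _)); congr iota; lia.
have fE t1 t2 t3 t4 : flatten [seq fblock (mm t1 t2 t3 t4) P i | i <- iota 0 n] =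
    A ++ nseq t1 (v p) ++ B ++ nseq t2 (v q) ++ C ++ nseq t3 (v r) ++
    D ++ nseq t4 (v s) ++ E.
  have seg a b : (forall j, (a <= j < a + b)%N ->
      [/\ j != p, j != q, j != r & j != s :> nat]) ->
      flatten [seq fblock (mm t1 t2 t3 t4) P i | i <- iota a b] = f (iota a b).
    move=> H; apply: fblock_eq => x; rewrite mem_iota => /H[].
    rewrite /mm -!val_eqE /= => /negbTE-> /negbTE-> /negbTE-> /negbTE->.
    by rewrite !muln0 !addn0.
  have blk (x : 'I_n) (t : bool) : mm t1 t2 t3 t4 x = (m x + t)%N ->
      fblock (mm t1 t2 t3 t4) P x = fblock m P x ++ nseq t (v x).
    move=> xE; rewrite !fblockE xE; case: t {xE}; last by rewrite addn0 cats0.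
    by rewrite addn1 (take_nth 0) ?size_vecs// cats1.
  have [pr ps qs] : [/\ p < r, p < s & q < s]%N.
    by split; [exact: ltn_trans pq qr|exact: ltn_trans pq (ltn_trans qr rs)|
      exact: ltn_trans qr rs].
  have mp : mm t1 t2 t3 t4 p = (m p + t1)%N.
    rewrite /mm -!val_eqE /= eqxx (ltn_eqF pq) (ltn_eqF pr) (ltn_eqF ps).
    by rewrite !muln0 muln1 !addn0.
  have mq : mm t1 t2 t3 t4 q = (m q + t2)%N.
    rewrite /mm -!val_eqE /= eqxx (gtn_eqF pq) (ltn_eqF qr) (ltn_eqF qs).
    by rewrite !muln0 muln1 !addn0.
  have mr : mm t1 t2 t3 t4 r = (m r + t3)%N.
    rewrite /mm -!val_eqE /= eqxx (gtn_eqF pr) (gtn_eqF qr) (ltn_eqF rs).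
    by rewrite !muln0 muln1 !addn0.
  have ms : mm t1 t2 t3 t4 s = (m s + t4)%N.
    rewrite /mm -!val_eqE /= eqxx (gtn_eqF ps) (gtn_eqF qs) (gtn_eqF rs).
    by rewrite !muln0 muln1.
  rewrite iE !map_cat !flatten_cat /= !map_cat !flatten_cat /= !map_cat.
  rewrite !flatten_cat /= !map_cat !flatten_cat /=.
  rewrite !seg; try by move=> j; split; apply/eqP; lia.
  by rewrite (blk p t1) ?(blk q t2) ?(blk r t3) ?(blk s t4) // /A /B /C /D -!catA.
have sE : (size A + size B + size C + size D + size E).+2 = k.
  apply: etrans mE; rewrite -(@size_fblocks m P) => [|x]; last exact: ltnW.
  rewrite (@fblock_eq m (mm false false false false) P) => [|x _].
    by rewrite fE /= !size_cat !addnA.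
  by rewrite /mm /= addn0.
have ME a b (t1 t2 t3 t4 : bool) : (forall x : 'I_n, ((a == x) + (b == x) =
    t1 * (x == p) + t2 * (x == q) + t3 * (x == r) + t4 * (x == s))%N) ->
    M a b = detseq (A ++ nseq t1 (v p) ++ B ++ nseq t2 (v q) ++ C ++
      nseq t3 (v r) ++ D ++ nseq t4 (v s) ++ E).
  move=> H; rewrite -fE -flag_minorE; apply: flag_minor_ext => x.
  by rewrite /mm -H addnA addnC.
have Mpq := ME p q true true false false; have Mrs := ME r s false false true true.
have Mpr := ME p r true false true false; have Mqs := ME q s false true false true.
have Mps := ME p s true false false true; have Mqr := ME q r false true true false.
rewrite Mpq ?Mrs ?Mpr ?Mqs ?Mps ?Mqr; first exact: pluecker sE.
all: by move=> x; rewrite !mul0n !mul1n ?addn0 ?add0n ![x == _]eq_sym.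
Qed.

(** An exponent written as a multiset of vertices, so that an exchange relation replaces letters. *)
Definition wminor w P : F := flag_minor (fun p => count_mem p w) P.

Lemma wminor_perm w w' P : perm_eq w w' -> wminor w P = wminor w' P.
Proof. by move=> /seq.permP E; apply: flag_minor_ext => p; exact: E. Qed.

Lemma sum_count_mem w : (\sum_p count_mem p w)%N = size w.
Proof.
elim: w => [|x w IH] /=; first by rewrite big1.
rewrite big_split IH /= (bigD1 x)//= eqxx big1 ?addn0// => p.
by rewrite eq_sym => /negbTE->.
Qed.

Lemma wminor_pluecker w P (p q r s : 'I_n) :
  (p < q)%N -> (q < r)%N -> (r < s)%N -> (size w).+2 = k ->
  wminor [:: p, r & w] P * wminor [:: q, s & w] P =
  wminor [:: p, q & w] P * wminor [:: r, s & w] P +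
  wminor [:: p, s & w] P * wminor [:: q, r & w] P.
Proof.
by move=> pq qr rs sw; apply: flag_pluecker => //; rewrite sum_count_mem.
Qed.

(** The minor is the determinant of a whole basis. Its exponent [k] at a single vertex is excluded
    from the charts, which is why this case is separate. *)
Lemma wminor_const w P p : size w = k -> (forall x, x \in w -> x = p) ->
  wminor w P = 1.
Proof.
move=> sw wp.
have cE x : count_mem x w = ((x == p) * k)%N.
  rewrite -sw; elim: w wp {sw} => [|u w IH] wp /=; first by rewrite muln0.
  rewrite IH => [|z zw]; last by apply: wp; rewrite inE zw orbT.
  by rewrite (wp u) ?mem_head// [p == x]eq_sym mulnS.
rewrite /wminor (flag_minor_ext P cE) flag_minorE.
have -> : flatten [seq fblock (fun x => ((x == p) * k)%N) P i | i <- iota 0 n] =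
    vecs (val (P p)).
  have lt := ltn_ord p; rewrite (@iota_split 0 n p) ?lt//.
  have nil a b : ~~ (a <= p < a + b)%N -> flatten
      [seq fblock (fun x => ((x == p) * k)%N) P i | i <- iota a b] = [::].
    move=> H; rewrite (@fblock_eq _ (fun=> 0%N)) => [|x].
      elim: (iota a b) => //= i l ->; rewrite /fblock.
      by case: insub => // x; rewrite take0.
    by rewrite mem_iota; case: eqP => // ->; rewrite (negbTE H).
  rewrite map_cat flatten_cat nil ?add0n ?subn0 ?ltnn//= nil; last by lia.
  by rewrite cats0 fblockE eqxx mul1n take_oversize// size_vecs.
by rewrite detseq_vecs (eqP (valP (P p))).
Qed.

End FlagMinors.

(** * Chords and triangles of a triangulation *)

Section Triangulations.
Variables (n : nat) (E : {set 'I_n * 'I_n}).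
Hypothesis triE : is_triangulation E.
Implicit Types (d e : 'I_n * 'I_n) (p q r x : 'I_n) (w : seq 'I_n).

Lemma chord_lt e : e \in E -> (e.1 < e.2)%N.
Proof. by case/and3P: triE => /forall_inP H _ _ /H. Qed.

Lemma chord_noncrossing d e : d \in E -> e \in E -> ~~ crossing d e.
Proof.
by case/and3P: triE => _ /forall_inP H _ /H /forall_inP K /K.
Qed.

Lemma chord_mem p q : (p < q)%N -> (forall e, e \in E -> ~~ crossing (p, q) e) ->
  (p, q) \in E.
Proof.
move=> pq H; case/and3P: triE => _ _ /forallP/(_ (p, q)) /=; rewrite pq /=.
by move/implyP; apply; apply/forall_inP.
Qed.

Lemma side_mem p q : q = p.+1 :> nat -> (p, q) \in E.
Proof.
move=> pq; apply: chord_mem => [|e /chord_lt]; first by rewrite pq.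
by rewrite /crossing /= pq; lia.
Qed.

Lemma edge_triangle p q : (3 <= n)%N -> (p, q) \in E ->
  exists a b c, [/\ triangle E a b c, p \in [:: a; b; c] & q \in [:: a; b; c]].
Proof.
move=> n3 pqE; have pq : (p < q)%N := chord_lt pqE.
have cr d e : d \in E -> e \in E ->
    ~ ((d.1 < e.1)%N /\ (e.1 < d.2)%N /\ (d.2 < e.2)%N) /\
    ~ ((e.1 < d.1)%N /\ (d.1 < e.2)%N /\ (e.2 < d.2)%N).
  by move=> dE eE; have := chord_noncrossing dE eE; rewrite /crossing; lia.
have done3 (a b c : 'I_n) : (a < b)%N -> (b < c)%N -> (a, b) \in E -> (b, c) \in E ->
    (a, c) \in E -> triangle E a b c by rewrite /triangle => -> -> -> -> ->.
(* If [p q] is not a side of consecutive vertices, take the largest [r < q] joined to [p]: a chord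
   crossing [r q] would have to start at [p] and end beyond [r]. *)
case: (ltnP p.+1 q) => [lt|le].
  have pn : (p.+1 < n)%N by apply: ltn_trans (ltn_ord q).
  pose P := [pred r : 'I_n | (r < q)%N && ((p, r) \in E)].
  have P0 : P (Ordinal pn) by rewrite /= lt side_mem.
  case: (arg_maxnP (fun r : 'I_n => r : nat) P0) => r /andP[rq prE] rmax.
  have pr := chord_lt prE; rewrite /= in pr.
  exists p, r, q; split; rewrite ?inE ?eqxx ?orbT//; apply: done3 => //.
  apply: chord_mem => // -[u v] eE; have /= uv := chord_lt eE.
  have /= c1 := cr _ _ pqE eE; have /= c2 := cr _ _ prE eE.
  apply/negP; rewrite /crossing /= => /orP[|] H; first by lia.
  have up : u = p by apply: val_inj => /=; lia.
  by have := rmax v; rewrite /= -up eE /=; lia.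
have qE : q = p.+1 :> nat by lia.
(* For consecutive vertices, the smallest vertex beyond [q] joined to [p] completes the triangle, if
   there is one. *)
have [/existsP[x0 /= P0]|/existsPn no] :=
  boolP [exists x : 'I_n, (q < x)%N && ((p, x) \in E)].
  case: (arg_minnP (P := [pred x : 'I_n | (q < x)%N && ((p, x) \in E)])
    (fun x : 'I_n => x : nat) P0) => x /andP[qx pxE] xmin.
  exists p, q, x; split; rewrite ?inE ?eqxx ?orbT//; apply: done3 => //.
  apply: chord_mem => // -[u v] eE; have /= uv := chord_lt eE.
  have /= c1 := cr _ _ pxE eE.
  apply/negP; rewrite /crossing /= => /orP[|] H; first by lia.
  have up : u = p by apply: val_inj => /=; lia.
  by have := xmin v; rewrite /= -up eE /=; lia.
(* Otherwise [p] is not 0, because the chord from 0 to [n - 1] crosses nothing and lies in [E]. The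
   smallest vertex joined to [p] then completes the triangle. *)
have p0 : (0 < p)%N.
  rewrite lt0n; apply/negP => /eqP p0; have n1 : (n.-1 < n)%N by lia.
  have := no (Ordinal n1); rewrite /= negb_and -leqNgt chord_mem ?orbF /=; try lia.
  by move=> e eE; rewrite /crossing /=; have := ltn_ord e.2; have := chord_lt eE; lia.
have zn : (p.-1 < n)%N by have := ltn_ord p; lia.
have z0p : p = (Ordinal zn).+1 :> nat by rewrite /=; lia.
case: (arg_minnP (P := [pred z : 'I_n | (z, p) \in E]) (fun x : 'I_n => x : nat)
  (side_mem z0p)) => z /= zpE zmin.
have /= zp := chord_lt zpE.
exists z, p, q; split; rewrite ?inE ?eqxx ?orbT//; apply: done3 => //.
apply: chord_mem => [|[u v] eE]; first by rewrite (ltn_trans zp).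
have /= uv := chord_lt eE; have /= c1 := cr _ _ zpE eE.
apply/negP; rewrite /crossing /= => /orP[|] H.
  have up : u = p by apply: val_inj => /=; lia.
  by have := no v; rewrite -up eE /=; lia.
have vp : v = p by apply: val_inj => /=; lia.
by have := zmin u; rewrite /= -vp eE /=; lia.
Qed.

Definition inside e x := (e.1 < x < e.2)%N.
Definition outside e x := (x < e.1)%N || (e.2 < x)%N.
Definition separates e w := has (inside e) w && has (outside e) w.

Lemma outside_inside e x : outside e x -> inside e x = false.
Proof.
by rewrite /inside => /orP[] h; rewrite (leq_gtF (ltnW h)) ?andbF.
Qed.

Lemma inside_outside e x : inside e x -> outside e x = false.
Proof. by move=> xi; apply: contraTF xi => /outside_inside->. Qed.

(** A chord of [E] crossing the chord between two letters would separate [w]; by maximality all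
    chords between letters are in [E]. Four distinct letters would yield two crossing chords, and if
    only two occur, their chord is an edge of some triangle. *)
Lemma unseparated_triangle w p0 : (3 <= n)%N -> p0 \in w ->
  (forall e, e \in E -> ~~ separates e w) ->
  (exists p, forall x, x \in w -> x = p) \/
  (exists p q, [/\ p \in w, q \in w & p != q]) /\
  exists a b c, triangle E a b c /\ {subset w <= [:: a; b; c]}.
Proof.
move=> n3 p0w H.
have edge x y : x \in w -> y \in w -> (x < y)%N -> (x, y) \in E.
  move=> xw yw xy; apply: chord_mem => // e eE; apply: contra (H e eE).
  rewrite /crossing /= => /orP[] h; apply/andP; split; apply/hasP.
  - by exists y => //; rewrite /inside; lia.
  - by exists x => //; rewrite /outside; lia.
  - by exists x => //; rewrite /inside; lia.
  - by exists y => //; rewrite /outside; lia.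
case: (arg_minnP (P := [pred x | x \in w]) (fun x : 'I_n => x : nat) p0w).
move=> p /= pw pmin.
case: (arg_maxnP (P := [pred x | x \in w]) (fun x : 'I_n => x : nat) p0w).
move=> s /= sw smax.
have [ps|ps] := eqVneq p s.
  left; exists p => x xw; apply/val_inj/anti_leq.
  by have := pmin x xw; have := smax x xw; rewrite ps => -> ->.
right; split; first by exists p, s.
have lt : (p < s)%N by rewrite ltn_neqAle ps pmin.
have [/existsP[x /and3P[xw px xs]]|/existsPn no] :=
    boolP [exists x, [&& x \in w, (p < x)%N & (x < s)%N]].
  exists p, x, s; split; first by rewrite /triangle px xs !edge.
  move=> y yw; rewrite !inE; have := pmin y yw; have := smax y yw => ys py.
  have [->|yp] := eqVneq y p; first by [].
  have [->|y_s] := eqVneq y s; first by rewrite orbT.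
  have {}py : (p < y)%N by rewrite ltn_neqAle eq_sym yp.
  have {}ys : (y < s)%N by rewrite ltn_neqAle y_s.
  rewrite orbF /=; apply/eqP/val_inj => /=; case: (ltngtP y x) => // yx.
    have := chord_noncrossing (edge p x pw xw px) (edge y s yw sw ys).
    by rewrite /crossing /=; lia.
  have := chord_noncrossing (edge p y pw yw py) (edge x s xw sw xs).
  by rewrite /crossing /=; lia.
have [a [b [c [T pT sT]]]] := edge_triangle n3 (edge p s pw sw lt).
exists a, b, c; split=> // y yw; have := no y; rewrite yw /=.
have := pmin y yw; have := smax y yw => ys py.
have [->//|yp] := eqVneq y p; have [->//|y_s] := eqVneq y s.
by rewrite !ltn_neqAle eq_sym yp py y_s ys.
Qed.

(* Chords of [E] do not cross the chord [d], so adding its endpoints to the part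
   of [w] on one side of [d] creates no new separation. *)
Lemma separates_side d e w w' : d \in E -> e \in E -> separates d w ->
  {subset w' <= [:: d.1, d.2 & w]} ->
  ~~ has (inside d) w' \/ ~~ has (outside d) w' ->
  separates e w' -> separates e w.
Proof.
move=> dE eE /andP[/hasP[r rw ri] /hasP[o ow oo]] sub side.
move=> /andP[/hasP[x xw' xi] /hasP[z zw' zo]].
have dlt := chord_lt dE; have elt := chord_lt eE.
have nc := chord_noncrossing dE eE.
have side' : (forall y, y \in w' -> ~~ inside d y) \/
    (forall y, y \in w' -> ~~ outside d y).
  by case: side => /hasPn; [left|right].
have main y : y \in w' -> y \in w \/ (y = d.1 \/ y = d.2).
  move/sub; rewrite !inE => /or3P[/eqP|/eqP|]; by [right; left|right; right|left].
have xs : ~~ inside d x /\ ~~ inside d z \/ ~~ outside d x /\ ~~ outside d z.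
  by case: side' => h; [left|right]; split; exact: h.
move: nc xs ri oo xi zo; rewrite /crossing /inside /outside => nc xs ri oo xi zo.
apply/andP; split; apply/hasP.
  case: (main x xw') => [xw|xd]; first by exists x.
  have /orP[h|h] : (e.1 < r < e.2)%N || (e.1 < o < e.2)%N.
    by case: xd => xd; rewrite xd in xs xi; lia.
  - by exists r.
  - by exists o.
case: (main z zw') => [zw|zd]; first by exists z.
have /orP[h|h] : ((r < e.1)%N || (e.2 < r)%N) || ((o < e.1)%N || (e.2 < o)%N).
  by case: zd => zd; rewrite zd in xs zo; lia.
- by exists r.
- by exists o.
Qed.

End Triangulations.

Lemma triangulation_exists n : exists E : {set 'I_n * 'I_n}, is_triangulation E.
Proof.
pose ok (E : {set 'I_n * 'I_n}) := [forall d in E, (d.1 < d.2)%N] &&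
  [forall d in E, forall e in E, ~~ crossing d e].
have ok0 : ok set0 by apply/andP; split; apply/forall_inP => d; rewrite inE.
have [E /maxsetP[/andP[E1 E2] Emax] _] := maxset_exists ok0.
exists E; rewrite /is_triangulation E1 E2 /=.
apply/forallP => d; apply/implyP => d12; apply/implyP => /forall_inP dE.
suff -> : E = d |: E by rewrite setU11.
apply/esym/Emax; last exact: subsetUr.
have crC (a b : 'I_n * 'I_n) : crossing a b = crossing b a.
  by rewrite /crossing; lia.
have crd : ~~ crossing d d by rewrite /crossing; lia.
apply/andP; split; apply/forall_inP => a; rewrite !inE => /orP[/eqP->//|aE].
- by move/forall_inP: E1; apply.
- apply/forall_inP => b; rewrite !inE => /orP[/eqP->//|bE]; exact: dE.
- apply/forall_inP => b; rewrite !inE => /orP[/eqP->|bE].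
    by rewrite crC; exact: dE.
  by move/forall_inP: E2 => /(_ a aE) /forall_inP; apply.
Qed.

(** * Flag minors as subtraction-free functions of one triangulation chart *)

Section PositiveMinors.
Variables (F : fieldType) (k n : nat) (E : triangulation n).
Hypotheses (k2 : (2 <= k)%N) (n3 : (3 <= n)%N).
Implicit Types (h : flags F k n -> F) (P : flags F k n) (w : seq 'I_n).

Definition exp_fun (m : exponents k E) : ratfun F (flags F k n) :=
  fun P => Some (flag_minor (expt m) P).

(* This pointwise condition, unlike [rateq], is stable under substitution. *)
Definition represents (e : sfexpr (exponents k E)) h :=
  forall P u, reval exp_fun e P = Some u -> u = h P.

Lemma represents_exchange h a b c d f :
  (forall P, h P * a P = b P * c P + d P * f P) ->
  (exists e, represents e a) -> (exists e, represents e b) ->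
  (exists e, represents e c) -> (exists e, represents e d) ->
  (exists e, represents e f) -> exists e, represents e h.
Proof.
move=> H [ea A] [eb B] [ec C] [ed D] [ef G].
exists (SDiv (SAdd (SMul eb ec) (SMul ed ef)) ea) => P u /=.
case Eb: (reval exp_fun eb P) => [b'|] //=.
case Ec: (reval exp_fun ec P) => [c'|] //=.
case Ed: (reval exp_fun ed P) => [d'|] //=.
case Ef: (reval exp_fun ef P) => [f'|] //=.
case Ea: (reval exp_fun ea P) => [a'|] //=.
case: eqP => // /eqP a0 [<-].
rewrite (B _ _ Eb) (C _ _ Ec) (D _ _ Ed) (G _ _ Ef) -H.
by rewrite (A _ _ Ea) in a0 *; rewrite mulfK.
Qed.

Lemma wminor_exponent w a b c : size w = k ->
  triangle (val E) a b c -> {subset w <= [:: a; b; c]} ->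
  (forall p, count_mem p w < k)%N ->
  exists m : exponents k E, forall P, wminor w P = flag_minor (expt m) P.
Proof.
move=> sw T sub lt; pose m := [ffun p => Ordinal (lt p)] : {ffun 'I_n -> 'I_k}.
have mE : is_exponent E m.
  apply/andP; split.
    apply/eqP; apply: etrans sw; rewrite -sum_count_mem.
    by apply: eq_bigr => p _; rewrite ffunE.
  apply/existsP; exists a; apply/existsP; exists b; apply/existsP; exists c.
  rewrite T; apply/forallP => p; apply/implyP; rewrite ffunE /= -lt0n -has_count.
  by case/hasP => x xw /eqP <-; exact: sub.
exists (exist _ m mE) => P; apply: flag_minor_ext => p.
by rewrite /expt /= ffunE.
Qed.

Lemma represents_wminor w : size w = k -> exists e, represents e (wminor w).
Proof.
(* Outer induction on the number of chords of [E] that separate the word. *)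
have triE := valP E; move: {2}_.+1 (ltnSn #|[set e in val E | separates e w]|) => N.
elim: N w => // N IHN w ltN sw.
have [p0 p0w] : exists p0, p0 \in w.
  by case: w sw {ltN} => [/= k0|x w _]; [by move: k2; rewrite -k0|exists x; rewrite mem_head].
have [/existsP[d /andP[dE dw]]|/existsPn no] :=
    boolP [exists d, (d \in val E) && separates d w]; last first.
  have [|[p pw]|[[p [q [pw qw pq]]] [a [b [c [T sub]]]]]] :=
      unseparated_triangle triE n3 p0w.
  - by move=> e eE; have := no e; rewrite eE.
  - by exists SOne => P u [<-]; rewrite (wminor_const P sw pw).
  - have lt x : (count_mem x w < k)%N.
      rewrite -sw ltn_neqAle count_size andbT -all_count.
      apply/negP => /allP al; case/eqP: pq.
      by rewrite (eqP (al p pw)) (eqP (al q qw)).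
    have [m mE] := wminor_exponent sw T sub lt.
    by exists (SVar m) => P u [<-]; rewrite mE.
(* Inner induction on the number of letters that are not endpoints of [d]. Once a word lies on one
   side of [d], strictly fewer chords separate it and the outer induction applies. *)
pose cnt w' := (count (inside d) w' + count (outside d) w')%N.
suff Q M w' : (cnt w' < M)%N -> size w' = k -> {subset w' <= [:: d.1, d.2 & w]} ->
    exists e, represents e (wminor w').
  by apply: (Q _ w (ltnSn _)) => // x xw; rewrite !inE xw !orbT.
elim: M w' => // M IHM w' ltM sw' sub.
have [side|] := boolP (~~ has (inside d) w' || ~~ has (outside d) w').
  apply: IHN => //; rewrite ltnS in ltN; apply: leq_trans ltN; apply: proper_card; apply/properP.
  split; last first.
    exists d; rewrite inE dE//= /separates.
    by move/orP: side => [/negbTE->|/negbTE->]; rewrite ?andbF.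
  apply/subsetP => e; rewrite !inE => /andP[eE es]; rewrite eE /=.
  by apply: (separates_side triE dE eE dw sub _ es); apply/orP.
rewrite negb_or !negbK => /andP[/hasP[r rw ri] /hasP[p pw po]].
have d12 := chord_lt triE dE.
have pr : p != r by apply: contraL ri => /eqP <-; rewrite (outside_inside po).
pose w0 := rem r (rem p w').
have perm : perm_eq w' [:: p, r & w0].
  rewrite (perm_trans (perm_to_rem pw))// perm_cons; apply: perm_to_rem.
  by move: rw; rewrite (perm_mem (perm_to_rem pw)) inE eq_sym (negbTE pr).
have sw0 : (size w0).+2 = k by rewrite -sw' (perm_size perm).
have sub0 : {subset w0 <= [:: d.1, d.2 & w]}.
  by move=> x xw0; apply: sub; rewrite (perm_mem perm) !inE xw0 !orbT.
have [d1i d2i d1o d2o] : [/\ inside d d.1 = false, inside d d.2 = false,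
    outside d d.1 = false & outside d d.2 = false].
  by rewrite /inside /outside !ltnn (leq_gtF (ltnW d12)) andbF.
have cnt0 : (cnt w0).+2 = cnt w'.
  rewrite /cnt (seq.permP perm (inside d)) (seq.permP perm (outside d)) /=.
  by rewrite po ri (outside_inside po) (inside_outside ri) !add0n !add1n addnS.
have R a b : a \in [:: d.1; d.2; p; r] -> b \in [:: d.1; d.2; p; r] ->
    (inside d a + outside d a + (inside d b + outside d b) < 2)%N ->
    exists e, represents e (wminor [:: a, b & w0]).
  move=> aS bS lt; apply: IHM => [|//|x].
    have aux (i1 o1 i2 o2 i0 o0 : nat) : (i1 + o1 + (i2 + o2) < 2)%N ->
      ((i0 + o0).+2 < M.+1)%N -> (i1 + (i2 + i0) + (o1 + (o2 + o0)) < M)%N.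
      by clear; lia.
    by apply: aux lt _; rewrite cnt0.
  have inS c : c \in [:: d.1; d.2; p; r] -> c \in [:: d.1, d.2 & w].
    rewrite inE => /orP[/eqP->|]; first by rewrite mem_head.
    rewrite inE => /orP[/eqP->|]; first by rewrite inE mem_head orbT.
    by rewrite !inE => /orP[]/eqP->; [have := sub p pw|have := sub r rw]; rewrite !inE.
  rewrite inE => /orP[/eqP->|]; first exact: inS.
  by rewrite inE => /orP[/eqP->|]; [exact: inS|exact: sub0].
have po' : (inside d p + outside d p = 1)%N.
  by rewrite po (outside_inside po).
have ri' : (inside d r + outside d r = 1)%N.
  by rewrite ri (inside_outside ri).
have pc a b P : wminor [:: a, b & w0] P = wminor [:: b, a & w0] P :> F.
  by apply: wminor_perm; apply/permPl; exact: (perm_catCA [:: a] [:: b]).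
have Rqs : exists e, represents e (wminor [:: d.1, d.2 & w0]).
  by apply: R; rewrite ?inE ?eqxx ?orbT// d1i d2i d1o d2o.
have Rpq : exists e, represents e (wminor [:: p, d.1 & w0]).
  by apply: R; rewrite ?inE ?eqxx ?orbT// d1i d1o po'.
have Rps : exists e, represents e (wminor [:: p, d.2 & w0]).
  by apply: R; rewrite ?inE ?eqxx ?orbT// d2i d2o po'.
have Rqr : exists e, represents e (wminor [:: d.1, r & w0]).
  by apply: R; rewrite ?inE ?eqxx ?orbT// d1i d1o ri'.
have Rrs : exists e, represents e (wminor [:: r, d.2 & w0]).
  by apply: R; rewrite ?inE ?eqxx ?orbT// d2i d2o ri'.
(* The chord between [p] and [r] crosses [d]. In the exchange relation each of the other five minors
   has at most one of [p], [r] besides [w0], hence fewer letters off [d]. *)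
apply: (represents_exchange (a := wminor [:: d.1, d.2 & w0])
  (b := wminor [:: p, d.1 & w0]) (c := wminor [:: r, d.2 & w0])
  (d := wminor [:: p, d.2 & w0]) (f := wminor [:: d.1, r & w0])) => // P.
(* The vertex [p] comes before [d.1] or after [d.2], which gives two linear orders of the four
   vertices. *)
rewrite (wminor_perm P perm); case/orP: po => po; move/andP: ri => [dr rd].
  by apply: wminor_pluecker.
have := wminor_pluecker P dr rd po sw0.
rewrite (pc r p) (pc d.2 p) (pc d.1 p) => H.
by rewrite mulrC H addrC [X in _ + X]mulrC.
Qed.

End PositiveMinors.

(** * Points of cluster varieties *)

Section Substitution.
Variables (I J : Type) (X : J -> sfexpr I).

Fixpoint sfsubst (e : sfexpr J) : sfexpr I :=
  match e with
  | SVar i => X i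
  | SOne => SOne
  | SAdd a b => SAdd (sfsubst a) (sfsubst b)
  | SMul a b => SMul (sfsubst a) (sfsubst b)
  | SDiv a b => SDiv (sfsubst a) (sfsubst b)
  end.

Lemma seval_subst (S : semifield) (y : I -> S) e :
  seval y (sfsubst e) = seval (fun j => seval y (X j)) e.
Proof. by elim: e => //= a -> b ->. Qed.

Lemma reval_subst (F : fieldType) (T : Type) (f : I -> ratfun F T) e P :
  reval f (sfsubst e) P = reval (fun j => reval f (X j)) e P.
Proof. by elim: e => //= a -> b ->. Qed.

End Substitution.

Lemma reval_comp (F : fieldType) (T T' I : Type) (f : I -> ratfun F T)
    (h : T' -> T) e P : reval (fun i Q => f i (h Q)) e P = reval f e (h P).
Proof. by elim: e => //= a -> b ->. Qed.

(** Denominators take positive values there, so no expression is undefined. *)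
Lemma reval_rpos (R : realType) (T I : Type) (f : I -> ratfun (complex R) T)
    (y : I -> rpt R) P :
  (forall i, f i P = Some (real_complex R (rpval (y i)))) ->
  forall e, reval f e P = Some (real_complex R (rpval (seval (S := Rpos R) y e))).
Proof.
move=> fE; elim=> [i||a IHa b IHb|a IHa b IHb|a IHa b IHb] /=;
  rewrite ?IHa ?IHb ?fE ?rmorph1//=; first by rewrite -rmorphD.
  by rewrite -rmorphM.
rewrite fmorph_eq0 gt_eqF ?rpval_gt0//.
by rewrite -fmorphV -rmorphM.
Qed.

(* Only coordinates are compared by [sfp_trans]; apply it to [i * (e / e')]. *)
Lemma sfpoint_rateq (F : fieldType) (Y : posvar F) (S : semifield)
    (z : sfpoint Y S) (c : pv_chart Y) (i : pv_crd c) (e e' : sfexpr (pv_crd c)) :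
  rateq (posfun e) (posfun e') -> seval (z c) e = seval (z c) e'.
Proof.
move=> H; have := @sfp_trans _ _ _ z c c i (SMul (SVar i) (SDiv e e')).
have eqz : rateq (pv_fun i) (posfun (SMul (SVar i) (SDiv e e'))).
  move=> P u v uE; rewrite /posfun /= uE.
  case Ee: (reval _ e P) => [a|] //=; case Ee': (reval _ e' P) => [b|] //=.
  case: eqP => // /eqP b0 [<-].
  by rewrite (H P a b Ee Ee') divff// mulr1.
move=> /(_ eqz) /=; set a := seval _ e; set b := seval _ e'; set u := z c i => E.
have cancel (v w : S) : sf_mul (sf_inv v) (sf_mul v w) = w.
  by rewrite sf_mulA sf_mulV sf_mul1.
have := congr1 (fun t => sf_mul (sf_mul (sf_inv u) t) b) E.
rewrite cancel sf_mulV sf_mul1 -sf_mulA sf_mulV => ->.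
by rewrite sf_mulC sf_mul1.
Qed.

Lemma sfpoint_ext (F : fieldType) (Y : posvar F) (S : semifield)
    (z z' : sfpoint Y S) : (forall c i, z c i = z' c i) -> z = z'.
Proof.
case: z z' => [f Hf] [g Hg] /= E; have fg : f = g.
  by apply: functional_extensionality_dep => c; apply/funext => i; exact: E.
by subst g; congr SfPoint; exact: Prop_irrelevance.
Qed.

Section ClusterPoints.
Variables (F : fieldType) (X : Type) (eqX : X -> X -> Prop).
Variables (T : Type) (I : T -> finType) (x : forall t, I t -> X -> F).
Variables (mut : forall t, pred (I t)) (B : forall t, I t -> I t -> int).
Hypothesis x_inv : forall t (i : I t) P Q, eqX P Q -> x i P = x i Q.
Local Notation Y := (cluster_variety mut B x_inv).

Definition base_fun t (i : I t) : ratfun F X := fun P => Some (x i P).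

Definition base_chart t : pv_chart Y := existT _ t [::].

Definition cl_expr (c : pv_chart Y) : pv_crd c -> sfexpr (I (projT1 c)) :=
  sd_x (mutations (@B (projT1 c)) (map val (projT2 c))).

Lemma posfun_cluster (c : pv_chart Y) (e : sfexpr (pv_crd c)) P :
  posfun e P = reval (@base_fun (projT1 c)) (sfsubst (@cl_expr c) e) P.
Proof. by rewrite reval_subst. Qed.

(** Cluster variables are by construction expressions in the base coordinates, so a point is
    determined by its values in the unmutated charts. *)
Lemma cluster_point (S : semifield) (z : sfpoint Y S) (c : pv_chart Y)
    (e : sfexpr (pv_crd c)) :
  seval (z c) e = seval (z (base_chart (projT1 c))) (sfsubst (@cl_expr c) e).
Proof.
rewrite seval_subst; congr seval; apply/funext => i.
apply: (@sfp_trans _ _ _ z (base_chart (projT1 c)) c i (@cl_expr c i)).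
by move=> P u v E1 E2; have : Some u = Some v by [rewrite -E1; exact: E2]; case.
Qed.

End ClusterPoints.

Section ClusterPointExistence.
Variables (R : realType) (X : Type) (eqX : X -> X -> Prop).
Variables (T : Type) (I : T -> finType) (x : forall t, I t -> X -> complex R).
Variables (mut : forall t, pred (I t)) (B : forall t, I t -> I t -> int).
Hypothesis x_inv : forall t (i : I t) P Q, eqX P Q -> x i P = x i Q.
Local Notation Y := (cluster_variety mut B x_inv).
Variables (J : finType) (Q : (J -> rpt R) -> X) (g : forall t, I t -> sfexpr J).
Hypothesis gE : forall y t (i : I t),
  x i (Q y) = real_complex R (rpval (seval (S := Rpos R) y (g i))).

Lemma posfun_cluster_rpos (c : pv_chart Y) (e : sfexpr (pv_crd c)) y :
  posfun e (Q y) = Some (real_complex R (rpval (seval (S := Rpos R) y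
    (sfsubst (@g (projT1 c)) (sfsubst (@cl_expr _ _ _ _ _ _ _ _ x_inv c) e))))).
Proof.
rewrite posfun_cluster (reval_rpos (y := fun i => seval (S := Rpos R) y (g i))).
  by rewrite -seval_subst.
by move=> i; rewrite /base_fun gE.
Qed.

(** A transition relation evaluated at [Q y'], for positive real [y'], is defined on both sides and
    becomes an identity of positive reals; [seval_transfer] carries it to [S]. *)
Lemma cluster_point_exists (S : semifield) (y : J -> S) :
  exists z : sfpoint Y S, forall t (i : I t),
    z (base_chart mut B x_inv t) i = seval y (g i).
Proof.
pose f (c : pv_chart Y) (i : pv_crd c) : S :=
  seval y (sfsubst (@g (projT1 c)) (@cl_expr _ _ _ _ _ _ _ _ x_inv c i)).
have fT c c' i e : rateq (@pv_fun _ Y c' i) (posfun e) -> f c' i = seval (@f c) e.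
  move=> H; transitivity (seval y
      (sfsubst (@g (projT1 c)) (sfsubst (@cl_expr _ _ _ _ _ _ _ _ x_inv c) e))).
    apply: (@seval_transfer R) => y'; apply/val_inj/(fmorph_inj (real_complex R)).
    have := posfun_cluster_rpos (SVar i) y'; rewrite /posfun /= => E1.
    exact: H E1 (posfun_cluster_rpos e y').
  rewrite seval_subst seval_subst; congr seval; apply/funext => j.
  by rewrite /f seval_subst.
by exists (SfPoint fT).
Qed.

End ClusterPointExistence.

(** * A subtraction-free section of the map to first vectors *)

Lemma enum_seg (T : Type) (x0 : T) (s : seq T) (k n a i : nat) :
  size s = n -> (a <= i)%N -> (a <= k)%N -> (i + (k - a) <= n)%N ->
  [seq nth x0 s p | p : 'I_n <- enum (seg k n a i)] =
  take a s ++ take (k - a) (drop i s).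
Proof.
move=> sn ai ak ikn.
have -> : [seq nth x0 s (p : 'I_n) | p <- enum (seg k n a i)] =
    [seq nth x0 s j | j <- [seq j <- iota 0 n | (j < a)%N || (i <= j < i + (k - a))%N]].
  rewrite -val_enum_ord filter_map -map_comp; congr map.
  by rewrite {1}/enum_mem -enumT; apply: eq_filter => j; rewrite /= inE.
have -> : iota 0 n = iota 0 a ++ iota a (i - a) ++ iota i (k - a) ++
    iota (i + (k - a)) (n - (i + (k - a))).
  by rewrite -iotaD -[in iota i _](subnKC ai) -iotaD -iotaD; congr iota; lia.
set f := fun j => (j < a)%N || _.
have fT b c : (forall j, (b <= j < b + c)%N -> f j) -> filter f (iota b c) = iota b c.
  by move=> H; apply/all_filterP/allP => j; rewrite mem_iota; exact: H.
have fF b c : (forall j, (b <= j < b + c)%N -> ~~ f j) -> filter f (iota b c) = [::].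
  move=> H; apply/eqP; rewrite -[_ == _]negbK -has_filter; apply/hasPn => j.
  by rewrite mem_iota; exact: H.
rewrite !filter_cat (fT 0%N a) ?(fF a) ?(fT i) ?fF; try by rewrite /f => j; lia.
rewrite cats0 /= map_cat !map_nth_iota ?drop0//; lia.
Qed.

Lemma segP (k n : nat) (J : segs k n) : exists a i,
  [/\ (a <= i)%N, (a <= k)%N, (i + (k - a) <= n)%N & val J = seg k n a i].
Proof.
have /existsP[a /existsP[i /and3P[ai ikn /eqP E]]] := valP J.
by exists a, i; split=> //; have := ltn_ord a; lia.
Qed.

Lemma size_enum_seg (k n : nat) (J : segs k n) : size (enum (val J)) = k.
Proof.
have [a [i [ai ak ikn ->]]] := segP J.
have := @enum_seg nat 0 (iota 0 n) k n a i (size_iota _ _) ai ak ikn.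
move=> /(congr1 size); rewrite size_map => ->.
by rewrite size_cat !size_takel ?size_drop ?size_iota; lia.
Qed.

(** The initial interval is the one chart member with several presentations [(a, i)], and
    [vectors_exist] prescribes its minor separately. *)
Lemma seg_initial (k n a i : nat) : (a == k) || (i == a) -> (a <= k)%N ->
  seg k n a i = seg k n 0 0.
Proof.
move=> H ak; apply/setP => j; rewrite !inE subn0 add0n ltn0 /=.
by case/orP: H => /eqP E; subst; lia.
Qed.

Lemma detseq_map (F F' : fieldType) (f : {rmorphism F -> F'}) k
    (s : seq 'rV[F]_k) : detseq (map (map_mx f) s) = f (detseq s).
Proof.
rewrite /detseq -det_map_mx; congr (\det _); apply/matrixP => i j; rewrite !mxE.
have [lt|le] := ltnP i (size s); first by rewrite (nth_map 0)// mxE.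
by rewrite !nth_default ?size_map// !mxE rmorph0.
Qed.

Lemma plucker_first_vectors (F : fieldType) (k n : nat) (J : {set 'I_n})
    (P : flags F k n) : (0 < k)%N ->
  plucker J (first_vectors P) = wminor (enum J) P.
Proof.
move=> k0; rewrite /plucker /wminor /flag_minor; congr detseq.
rewrite /image_mem {1}/enum_mem -enumT; elim: (enum 'I_n) => //= p s IH.
rewrite count_uniq_mem ?enum_uniq// mem_enum -IH.
case: (p \in J) => /=; last by rewrite take0.
rewrite /first_vectors; case: (vecs _) (size_vecs (val (P p))) => [/= E|v l _ /=].
  by rewrite -E in k0.
by rewrite take0.
Qed.

(** Exhibits a flag minor as a maximal minor of the concatenated bases, so that [Pos] applies to
    it. *)
Lemma mask_take_blocks (T D : Type) (f : D -> seq T) (m : D -> nat) k (s : seq D) :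
  (forall p, size (f p) = k) -> (forall p, m p <= k)%N ->
  let b := flatten [seq nseq (m p) true ++ nseq (k - m p) false | p <- s] in
  [/\ size b = size (flatten (map f s)), count id b = sumn (map m s) &
    mask b (flatten (map f s)) = flatten [seq take (m p) (f p) | p <- s]].
Proof.
move=> sf mk; elim: s => //= p s [sb cb mb].
have sp : size (nseq (m p) true ++ nseq (k - m p) false) = k.
  by rewrite size_cat !size_nseq subnKC.
split.
- by rewrite !size_cat -sb !size_nseq sf subnKC.
- by rewrite !count_cat cb !count_nseq /= mul1n mul0n addn0.
rewrite mask_cat ?sp ?sf// mb; congr (_ ++ _).
rewrite -{1}[f p](cat_take_drop (m p)) mask_cat; last first.
  by rewrite size_nseq size_takel ?sf.
by rewrite mask_true ?size_takel ?sf// mask_false cats0.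
Qed.

Section PositiveSection.
Variables (R : realType) (k n : nat).
Hypotheses (k2 : (2 <= k)%N) (kn : (k <= n)%N).
Let I := segs k n.
Local Notation C := (real_complex R).

Theorem positive_section :
  exists Q : (I -> rpt R) -> flags (complex R) k n,
    (forall m : 'I_n -> nat, (\sum_p m p)%N = k -> exists e : sfexpr I,
       forall y, flag_minor m (Q y) = C (rpval (seval (S := Rpos R) y e))) /\
    (forall y (J : I), plucker (val J) (first_vectors (Q y)) = C (rpval (y J))).
Proof.
have k0 : (0 < k)%N by lia.
(* The value 1 is a default for pairs [(a, i)] that give no chart coordinate. *)
pose z a i (y : I -> rpt R) : R :=
  if insub (seg k n a i) is Some J then rpval (y J) else 1.
have zS a i : SF (z a i).
  by rewrite /z; case: insub => [J|]; [exact: SF_var|exact: SF1].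
have [|L [sL P D E0 E]] := @vectors_exist R I k n (z 0%N 0%N) z _ (zS _ _) zS.
  by rewrite k0.
have [|Bs [sBs BP BE]] := flag_blocks _ P D; first by rewrite k2 sL.
rewrite sL in sBs BE.
pose M (p : 'I_n) (y : I -> rpt R) : 'M[R]_k :=
  \matrix_(j < k) (at_ (nth [::] Bs p) y)`_j.
have sB (p : 'I_n) y : size (at_ (nth [::] Bs p) y) = k.
  by rewrite size_at; case: (BE p (ltn_ord p)).
have M1 p y : \det (map_mx C (M p y)) == 1.
  rewrite det_map_mx; have [_ dB _] := BE p (ltn_ord p).
  by rewrite -[\det _]/(detseq (at_ (nth [::] Bs p) y)) dB rmorph1.
pose Q y : flags (complex R) k n := fun p => exist _ (map_mx C (M p y)) (M1 p y).
have vE p y : vecs (val (Q y p)) = map (map_mx C) (at_ (nth [::] Bs p) y).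
  apply: (@eq_from_nth _ 0) => [|i]; first by rewrite size_vecs size_map sB.
  rewrite size_vecs => ik; rewrite (nth_map 0) ?sB//.
  rewrite (nth_map (Ordinal ik)) ?size_enum_ord//.
  have -> : nth (Ordinal ik) (enum 'I_k) i = Ordinal ik := nth_ord_enum _ (Ordinal ik).
  by apply/rowP => j; rewrite !mxE.
exists Q; split=> [m mE|y J].
  have mk p : (m p <= k)%N by rewrite -mE (bigD1 p)//= leq_addr.
  have BsE : flatten Bs = flatten [seq nth [::] Bs (p : 'I_n) | p <- enum 'I_n].
    congr flatten; rewrite -[LHS](mkseq_nth [::]) sBs /mkseq -val_enum_ord.
    by rewrite -map_comp.
  have BEs p : size (nth [::] Bs (p : 'I_n)) = k by case: (BE p (ltn_ord p)).
  have [sb cb mb] := mask_take_blocks (f := fun p : 'I_n => nth [::] Bs p)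
    (enum 'I_n) BEs mk.
  rewrite -BsE in sb mb.
  have cE : sumn (map m (enum 'I_n)) = k by rewrite sumnE big_map big_enum.
  have [e eE] := BP _ sb (etrans cb cE); exists e => y; rewrite -eE -detseq_map.
  rewrite -at_mask mb /flag_minor /at_ map_flatten map_flatten -2!map_comp.
  congr (detseq (flatten _)); apply: eq_map => p /=.
  by rewrite vE -!map_take.
have hE p : first_vectors (Q y) p = map_mx C ((at_ L y)`_p).
  rewrite /first_vectors vE; have [_ _ hB] := BE p (ltn_ord p).
  have := hB y; have := sB p y; case: (at_ _ _) => [/= ke|v l _ /= ->].
    by exfalso; lia.
  by congr map_mx; rewrite (nth_map (fun=> 0)) ?sL.
have PlE i0 a : (a <= i0)%N -> (a <= k)%N -> (i0 + (k - a) <= n)%N ->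
    val J = seg k n a i0 -> plucker (val J) (first_vectors (Q y)) =
      C (detseq (take a (at_ L y) ++ take (k - a) (drop i0 (at_ L y)))).
  move=> ai ak ikn ->; rewrite -(enum_seg 0 _ ai ak ikn) ?size_at//.
  rewrite -detseq_map /plucker -map_comp; congr detseq.
  by apply: eq_map => p; rewrite /= hE.
have [a [i0 [ai ak ikn JE]]] := segP J; rewrite (PlE i0 a ai ak ikn JE).
have zJ b j : val J = seg k n b j -> z b j y = rpval (y J).
  rewrite /z => <-; by rewrite valK.
have [init|] := boolP ((a == k) || (i0 == a)); last first.
  rewrite negb_or => /andP[ak' ia]; rewrite E ?zJ//.
    by rewrite ltn_neqAle ak'.
  by rewrite ltn_neqAle eq_sym ia.
have -> : take a (at_ L y) ++ take (k - a) (drop i0 (at_ L y)) = take k (at_ L y).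
  case/orP: init => /eqP E1; first by rewrite E1 subnn take0 cats0.
  by rewrite E1 -takeD subnKC.
by rewrite E0 zJ// JE seg_initial.
Qed.

End PositiveSection.

(** * Change of triangulation and transport of points along the first-vector map *)

Lemma represents_minor (F : fieldType) (k n : nat) (E : triangulation n)
    (m : 'I_n -> nat) : (2 <= k)%N -> (3 <= n)%N -> (\sum_p m p)%N = k ->
  exists e : sfexpr (exponents k E), represents (F := F) e (flag_minor m).
Proof.
move=> k2 n3 mE; pose w := flatten [seq nseq (m p) p | p <- enum 'I_n].
have wE p : count_mem p w = m p.
  rewrite count_flatten -map_comp sumnE big_map big_enum (bigD1 p)//=.
  rewrite count_nseq /= eqxx mul1n big1 ?addn0// => q qp.
  by rewrite count_nseq /= (negbTE qp).
have sw : size w = k by rewrite -sum_count_mem -[RHS]mE; apply: eq_bigr.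
have [e eE] := represents_wminor F E k2 n3 sw.
by exists e => P u /eE ->; apply: flag_minor_ext.
Qed.

(** Replacing functions by expressions representing them can only shrink the domain: where the
    result is defined, all intermediate values agree. *)
Lemma represents_subst (F : fieldType) (k n : nat) (E : triangulation n)
    (J : Type) (s : J -> sfexpr (exponents k E)) (h : J -> flags F k n -> F) :
  (forall j, represents (s j) (h j)) ->
  forall e P u, reval (@exp_fun F k n E) (sfsubst s e) P = Some u ->
    reval (fun j P => Some (h j P)) e P = Some u.
Proof.
move=> H; elim=> [j||a IHa b IHb|a IHa b IHb|a IHa b IHb] P u //=.
- by move=> /H ->.
- case Ea: (reval _ (sfsubst s a) P) => [a'|] //=.
  case Eb: (reval _ (sfsubst s b) P) => [b'|] //=.
  by rewrite (IHa _ _ Ea) (IHb _ _ Eb).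
- case Ea: (reval _ (sfsubst s a) P) => [a'|] //=.
  case Eb: (reval _ (sfsubst s b) P) => [b'|] //=.
  by rewrite (IHa _ _ Ea) (IHb _ _ Eb).
- case Ea: (reval _ (sfsubst s a) P) => [a'|] //=.
  case Eb: (reval _ (sfsubst s b) P) => [b'|] //=.
  by rewrite (IHa _ _ Ea) (IHb _ _ Eb).
Qed.

(** Needed because [sfpoint_rateq] compares two expressions through some coordinate of the chart. *)
Lemma exponents_inhabited (k n : nat) (E : triangulation n) :
  (2 <= k)%N -> (3 <= n)%N -> exists m : exponents k E, True.
Proof.
move=> k2 n3; have n0 : (0 < n)%N by lia.
have n1 : (1 < n)%N by lia.
have [p [q pq]] : exists p q : 'I_n, q = p.+1 :> nat.
  by exists (Ordinal n0), (Ordinal n1).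
pose w := rcons (nseq k.-1 p) q.
have [a [b [c [T pT qT]]]] : exists a b c, [/\ triangle (val E) a b c,
    p \in [:: a; b; c] & q \in [:: a; b; c]].
  by apply: (edge_triangle (valP E)) => //; apply: (side_mem (valP E)).
have [|||x|m _] := @wminor_exponent rat k n E w a b c.
- by rewrite size_rcons size_nseq prednK//; lia.
- exact: T.
- by move=> x; rewrite mem_rcons inE mem_nseq => /orP[/eqP->//|/andP[_ /eqP->]].
- rewrite /w -cats1 count_cat count_nseq /=; have [<-|px] := eqVneq p x.
    by rewrite -val_eqE /= pq (gtn_eqF (ltnSn p)) mul1n !addn0; lia.
  by rewrite mul0n addn0 add0n; case: (_ == _); lia.
by exists m.
Qed.

Theorem corollary3p9 (R : realType) (k n : nat)
    (hk : (2 <= k)%N) (hn : (maxn k 3 <= n)%N) :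
  let A := ConfA (complex R) k n in
  let V := ConfV (complex R) k n in
  let pi := @conf_pi (complex R) k n in
  positive_map (Y1 := A) (Y2 := V) pi /\
  exists pit : sfpoint A Zt -> sfpoint V Zt,
    [/\ is_trop pi pit /\ (forall pit', is_trop pi pit' -> pit' = pit),
        forall yt : sfpoint V Zt, exists xt : sfpoint A Zt, pit xt = yt
      & forall (y : sfpoint V (Kpos R)) (yt : sfpoint V Zt)
               (xt : sfpoint A Zt),
          is_nval y yt -> pit xt = yt ->
          exists x : sfpoint A (Kpos R), maps_to pi x y].
Proof.
move=> A V pi; move: hn; rewrite geq_max => /andP[kn n3].
pose F := complex R; pose baseV : pv_chart V := existT _ tt [::].
pose baseA (E : triangulation n) : pv_chart A := existT _ E [::].
have [E0 triE0] := triangulation_exists n; pose T0 : triangulation n := exist _ E0 triE0.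
pose plu (J : segs k n) (P : flags F k n) := plucker (val J) (first_vectors P).
have pluE (J : segs k n) : exists e : sfexpr (exponents k T0), represents e (plu J).
  have [e eE] := represents_wminor F T0 hk n3 (size_enum_seg J).
  by exists e => P u /eE ->; rewrite /plu plucker_first_vectors//; lia.
have [gJ gJE] := choice pluE.
pose exV (c : pv_chart V) := @cl_expr _ _ _ _ _ _ _ _
  (fun _ J v w E => plucker_inv (val J) E) c.
pose exA (c : pv_chart A) := @cl_expr _ _ _ _ _ _ _ _
  (fun _ m P Q E => flag_minor_inv (expt m) E) c.
have posV (c : pv_chart V) (g : sfexpr (pv_crd c)) P :
    posfun g (pi P) = reval (fun J P => Some (plu J P)) (sfsubst (@exV c) g) P.
  rewrite /exV posfun_cluster; symmetry.
  exact: (reval_comp (fun J v => Some (plucker (val J) v)) (@first_vectors F k n)).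
have posA (c : pv_chart A) (f : sfexpr (pv_crd c)) P :
    posfun f P = reval (@exp_fun F k n (projT1 c)) (sfsubst (@exA c) f) P.
  by rewrite /exA posfun_cluster.
have pm : positive_map (Y1 := A) (Y2 := V) pi.
  move=> c2 g; exists (baseA T0), (sfsubst gJ (sfsubst (@exV c2) g)).
  move=> P u v; rewrite posV => E1 /(represents_subst gJE); rewrite E1.
  by case.
split=> //.
(* Every coordinate on the target has a positive pullback, so [maps_to] determines the image. *)
have ext (S : semifield) (x : sfpoint A S) (y y' : sfpoint V S) :
    maps_to pi x y -> maps_to pi x y' -> y = y'.
  move=> H H'; apply: sfpoint_ext => c i.
  have [c1 [f fE]] := pm c (SVar i).
  by have := H c (SVar i) c1 f fE; have := H' c (SVar i) c1 f fE => /= -> ->.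
have [Q [QA QV]] := positive_section R hk kn.
have down (S : semifield) (x : sfpoint A S) : exists y : sfpoint V S, maps_to pi x y.
  (* The base coordinates of the image are the pulled-back Plücker coordinates of [x]. The vectors
     of [Q y] realize all positive coordinate values, which makes these data compatible with every
     cluster. *)
  have [y yE] := @cluster_point_exists R _ _ unit (fun=> segs k n)
    (fun _ J => plucker (val J)) (fun=> predC (@frozen_seg k n)) (fun=> @seg_B k n)
    (fun _ J v w E => plucker_inv (val J) E) _ (fun y => first_vectors (Q y))
    (fun _ J => SVar J) (fun y _ J => QV y J) S
    (fun J => seval (x (baseA T0)) (gJ J)).
  exists y => -[[] w2] g [E w] f pb.
  (* The given pullback [f] may belong to another triangulation [E]. The coordinates for [T0] are
     rewritten in [E], so that both expressions can be compared in one chart. *)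
  have trs (i : exponents k T0) : exists e : sfexpr (exponents k E),
      represents (F := F) e (flag_minor (expt i)).
    by apply: represents_minor => //; case/andP: (valP i) => /eqP.
  have [tr trE] := choice trs.
  have xtr i : x (baseA T0) i = seval (x (baseA E)) (tr i).
    apply: (@sfp_trans _ _ _ x (baseA E) (baseA T0) i (tr i)).
    by move=> P u v [<-] H; symmetry; apply: trE H.
  have [i0 _] := exponents_inhabited E hk n3.
  rewrite [LHS]cluster_point [RHS]cluster_point.
  rewrite -/(exV (existT _ tt w2)) -/(exA (existT _ E w)).
  have -> : seval (y baseV) (sfsubst (@exV (existT _ tt w2)) g) = seval (x (baseA E))
      (sfsubst tr (sfsubst gJ (sfsubst (@exV (existT _ tt w2)) g))).
    rewrite [RHS]seval_subst.
    have -> : (fun j => seval (x (baseA E)) (tr j)) = x (baseA T0).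
      by apply/funext => j; rewrite xtr.
    rewrite [RHS]seval_subst; congr seval; apply/funext => J; exact: (yE tt J).
  apply: (@sfpoint_rateq _ A S x (baseA E) i0) => P u v.
  move=> /(represents_subst trE) E1.
  have {}E1 := represents_subst gJE E1.
  rewrite -[posfun _ P]/(reval _ _ P) -(posA (existT _ E w)) => E2.
  by apply: (pb P u v) E2; rewrite posV.
have lift (S : semifield) (y : sfpoint V S) : exists x : sfpoint A S, maps_to pi x y.
  (* Indexed by all exponent functions, with default [SOne] for a wrong total, so that one choice
     serves every triangulation. *)
  have fms (m : {ffun 'I_n -> 'I_k}) : exists e : sfexpr (segs k n),
      (\sum_p m p)%N = k -> forall y', flag_minor (fun p => m p : nat) (Q y') =
        real_complex R (rpval (seval (S := Rpos R) y' e)).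
    have [mE|ne] := pselect ((\sum_p m p)%N = k); last by exists SOne.
    by have [e eE] := QA _ mE; exists e.
  have [fm fmE] := choice fms.
  have fmQ y' (E : triangulation n) (m : exponents k E) :
      flag_minor (expt m) (Q y') =
      real_complex R (rpval (seval (S := Rpos R) y' (fm (val m)))).
    by apply: fmE; case/andP: (valP m) => /eqP.
  have [x xE] := @cluster_point_exists R _ _ (triangulation n)
    (@exponents k n) (fun _ m => flag_minor (expt m))
    (fun E => predC (@frozen_exponent k n E)) (@exp_B k n)
    (fun _ m P Q E => flag_minor_inv (expt m) E) _ Q
    (fun _ m => fm (val m)) fmQ S (y baseV).
  exists x => -[[] w2] g c1 f pb.
  rewrite [LHS]cluster_point [RHS]cluster_point -/(exV (existT _ tt w2)) -/(exA c1).
  have -> : seval (x (baseA (projT1 c1))) (sfsubst (@exA c1) f) =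
      seval (y baseV) (sfsubst (fun m => fm (val m)) (sfsubst (@exA c1) f)).
    rewrite [RHS]seval_subst; congr seval; apply/funext => m; exact: xE.
  (* Over the positive reals the claim is the pullback identity at [Q y'], whose chart Plücker
     coordinates are [y']. *)
  apply: (@seval_transfer R) => y'.
  apply/val_inj/(fmorph_inj (real_complex R)); apply: (pb (Q y')).
    rewrite posV; apply: (@reval_rpos R _ _ _ y') => J.
    by rewrite /plu QV.
  rewrite posA (@reval_rpos R _ _ _
    (fun m => seval (S := Rpos R) y' (fm (val m)))) ?seval_subst// => m.
  by rewrite /exp_fun fmQ.
have [pit pitE] := choice (down Zt).
exists pit; split=> [|yt|y yt xt _ _]; last exact: lift.
  split=> // pit' pit'E; apply/funext => x; exact: ext (pit'E x) (pitE x).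
have [xt xtE] := lift Zt yt; exists xt; exact: ext (pitE xt) xtE.
Qed.
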